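(* For $k=3$, the minimum maximum density satisfies $\tau_3^*\ge 12/11$. Hence, the integrality gap of the geometric relaxation of the $3$-way cut problem is $12/11$.
   Context: Let $k\ge 3$ and $\Delta=\{x\in\mathbb{R}^k : x\ge 0,\ \sum_i x_i=1\}$; its $i$-th vertex is the point with $x_i=1$. The length $|e|$ of a line segment $e$ in $\Delta$ is half the $L_1$ distance between its endpoints. Multiway cut. An instance is a finite undirected graph $G$ with nonnegative edge costs and $k$ distinguished nodes, terminals $1,\dots,k$. A $k$-way cut of $G$ is a set of edges whose removal disconnects each terminal from all the others; its cost is the sum of the costs of its edges. Geometric relaxation. An embedding of $G$ maps each node to a point of $\Delta$, with terminal $i$ mapped to the $i$-th vertex of $\Delta$; each edge is mapped to the straight segment between the images of its endpoints. The volume of the embedding is $\mathrm{vol}(G)=\sum_{e}\mathrm{cost}(e)\cdot|e|$. The relaxation asks for a minimum-volume embedding. Its integrality gap is the supremum, over all instances $G$ (with positive minimum volume), of the minimum cost of any $k$-way cut of $G$ divided by the minimum volume of any embedding of $G$. Cutting schemes. A $k$-way cut of the simplex is a partition of $\Delta$ into $k$ polytopes (polyhedral regions, not necessarily convex), each containing exactly one vertex of $\Delta$. A cutting scheme is a probability distribution $P$ on $k$-way cuts of $\Delta$. For a segment $e$ of positive length, $\tau_k(P,e)$ is the expected number of times a random cut from $P$ cuts $e$ (the number of points of $e$ at which $e$ crosses a boundary between blocks), divided by $|e|$; $\tau_k(P)=\sup_e\tau_k(P,e)$ and $\tau_k^*=\inf_P\tau_k(P)$ over all cutting schemes $P$.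 *)

(* Defs.v *)
From HB Require Import structures.
From mathcomp Require Import all_boot all_order all_algebra.
From mathcomp Require Import all_classical all_reals all_analysis.
From mathcomp Require Import measurable_realfun.

Set Implicit Arguments.
Unset Strict Implicit.
Unset Printing Implicit Defensive.

Import Order.TTheory GRing.Theory Num.Theory.
Import numFieldNormedType.Exports.

Local Open Scope classical_set_scope.
Local Open Scope ring_scope.

Section Simplex.
Context (R : realType) (k : nat).
Implicit Types (p q x y : 'cV[R]_k).

Definition simplex : set 'cV[R]_k :=
  [set x | (forall i, 0 <= x i 0) /\ \sum_i x i 0 = 1].

Definition simplex_vertex (i : 'I_k) : 'cV[R]_k := delta_mx i 0.

Definition segment p q : set 'cV[R]_k :=
  [set p + t *: (q - p) | t in [set t : R | 0 <= t <= 1]].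

Definition seg_length p q : R := 2^-1 * \sum_i `|p i 0 - q i 0|.

End Simplex.
Arguments simplex : clear implicits.
Arguments simplex_vertex R {k} i.

Section MultiwayCut.
Context (R : realType) (k : nat).

(* The names [src] and [dst] fix an arbitrary orientation of each edge; every
   notion below is invariant under reversing edges. *)
Record instance := Instance {
  node : finType;
  edge : finType;
  src : edge -> node;
  dst : edge -> node;
  no_loop : forall e, src e != dst e;
  no_parallel : injective (fun e => [set src e; dst e]%SET);
  cost : edge -> R;
  cost_ge0 : forall e, 0 <= cost e;
  terminal : 'I_k -> node;
  terminal_inj : injective terminal }.

Definition adjacent_without (G : instance) (F : {set edge G}) : rel (node G) :=
  fun u v => [exists e, (e \notin F) &&
    (((src e == u) && (dst e == v)) || ((src e == v) && (dst e == u)))].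

Definition kway_cut (G : instance) : set {set edge G} :=
  [set F | forall i j, i != j ->
     ~~ connect (adjacent_without F) (terminal G i) (terminal G j)].
Arguments kway_cut : clear implicits.

Definition cut_cost (G : instance) (F : {set edge G}) : R :=
  \sum_(e in F) cost e.

Definition min_cut_cost (G : instance) : R :=
  inf [set cut_cost F | F in kway_cut G].

Definition embedding (G : instance) : set (node G -> 'cV[R]_k) :=
  [set f | (forall v, simplex R k (f v)) /\
           (forall i, f (terminal G i) = simplex_vertex R i)].
Arguments embedding : clear implicits.

Definition volume (G : instance) (f : node G -> 'cV[R]_k) : R :=
  \sum_e cost e * seg_length (f (src e)) (f (dst e)).

Definition min_volume (G : instance) : R :=
  inf [set volume f | f in embedding G].

Definition integrality_gap : \bar R :=
  ereal_sup [set r | exists G : instance,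
    0 < min_volume G /\ r = (min_cut_cost G / min_volume G)%:E].

End MultiwayCut.

Section SimplexCut.
Context (R : realType) (k : nat).

(* [x < y ?<= if c] is [x <= y] when [c] holds and [x < y] otherwise. Strict
   inequalities are needed since the blocks of a cut partition the simplex. *)
Definition convex_polyhedron (A : set 'cV[R]_k) : Prop :=
  exists (I : finType) (a : I -> 'rV[R]_k) (b : I -> R) (c : I -> bool),
    A = [set x | forall i, (a i *m x) 0 0 < b i ?<= if c i].

Definition polyhedral (A : set 'cV[R]_k) : Prop :=
  exists (J : finType) (C : J -> set 'cV[R]_k),
    (forall j, convex_polyhedron (C j)) /\ A = \bigcup_j C j.

(* The block containing vertex [i] is the one with index [i]. *)
Record simplex_cut := SimplexCut {
  block : 'I_k -> set 'cV[R]_k;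
  block_partition : partition [set: 'I_k] block (simplex R k);
  block_polyhedral : forall i, polyhedral (block i);
  block_vertex : forall i j, block i (simplex_vertex R j) <-> j = i }.

(* The points of [segment p q] near which the segment does not stay inside a
   single block. *)
Definition crossings (c : simplex_cut) (p q : 'cV[R]_k) : set 'cV[R]_k :=
  [set x | segment p q x /\
     forall i, ~ \forall y \near within (segment p q) (nbhs x), block c i y].

Definition crossing_number (p q : 'cV[R]_k) (c : simplex_cut) : \bar R :=
  counting (crossings c p q).

(* An inhabitant of [simplex_cut], required for its measurable structure: every
   vertex but one is cut off as a singleton block. *)
Let trivial_block (i : 'I_k) : set 'cV[R]_k :=
  if val i == 0%N
  then simplex R k `&` [set x | forall j : 'I_k, val j != 0%N -> x j 0 < 1]
  else simplex R k `&` [set x | 1 <= x i 0].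

Let convex_polyhedron_lower (P : pred 'I_k) (c : 'I_k -> bool) (m : R) (s : R) :
  convex_polyhedron (simplex R k `&`
    [set x | forall j, P j -> s * x j 0 < m ?<= if c j]).
Proof.
pose a (i : 'I_k + bool + 'I_k) : 'rV[R]_k :=
  match i with
  | inl (inl i) => - delta_mx 0 i
  | inl (inr b) => (if b then 1 else -1) *: const_mx 1
  | inr i => if P i then s *: delta_mx 0 i else 0 end.
pose b (i : 'I_k + bool + 'I_k) : R := match i with
  | inl (inl i) => 0
  | inl (inr b) => if b then 1 else -1
  | inr i => if P i then m else 0 end.
pose d (i : 'I_k + bool + 'I_k) : bool := match i with
  | inl _ => true
  | inr i => if P i then c i else true end.
have deltaE (i : 'I_k) (x : 'cV[R]_k) : (delta_mx 0 i *m x : 'cV[R]_1) 0 0 = x i 0.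
  by rewrite -rowE mxE.
have sumE (x : 'cV[R]_k) : (const_mx 1 *m x : 'cV[R]_1) 0 0 = \sum_i x i 0.
  by rewrite mxE; apply: eq_bigr => i _; rewrite mxE mul1r.
exists ('I_k + bool + 'I_k)%type, a, b, d.
apply/seteqP; split => x /=.
- move=> [[x0 x1] xP] [[i|[]]|i] /=.
  + by rewrite mulNmx mxE deltaE oppr_le0.
  + by rewrite scale1r sumE x1.
  + by rewrite scaleN1r mulNmx mxE sumE x1.
  + case Pi: (P i); last by rewrite mul0mx mxE /= lexx.
    by rewrite -scalemxAl mxE deltaE; exact: xP.
- move=> H; split; first split.
  + by move=> i; have := H (inl (inl i)); rewrite /= mulNmx mxE deltaE oppr_le0.
  + apply/eqP; rewrite eq_le; apply/andP; split.
      by have := H (inl (inr true)); rewrite /= scale1r sumE.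
    by have := H (inl (inr false)); rewrite /= scaleN1r mulNmx mxE sumE lerN2.
  + move=> j Pj; have := H (inr j).
    by rewrite /= Pj -scalemxAl mxE deltaE.
Qed.

Let trivial_polyhedral i : polyhedral (trivial_block i).
Proof.
exists unit, (fun _ => trivial_block i); split; last first.
  by apply/seteqP; split => [x xi|x [_ _]]; [exists tt|].
move=> _; rewrite /trivial_block; case: ifPn => i0.
  have := convex_polyhedron_lower (fun j => val j != 0%N) (fun=> false) 1 1.
  by congr (convex_polyhedron (_ `&` _)); apply/seteqP; split => x /= H j /H;
    rewrite mul1r.
have := convex_polyhedron_lower (pred1 i) (fun=> true) (-1) (-1).
congr (convex_polyhedron (_ `&` _)); apply/seteqP; split => x /=.
  by move=> /(_ i (eqxx _)); rewrite mulN1r lerN2.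
by move=> xi j /eqP ->; rewrite mulN1r lerN2.
Qed.

Let simplex_vertexP (i : 'I_k) : simplex R k (simplex_vertex R i).
Proof.
split=> [j|]; first by rewrite mxE.
rewrite (bigD1 i)//= mxE !eqxx big1 ?addr0// => j ji.
by rewrite mxE (negbTE ji).
Qed.

Let simplex_eq1 x (i j : 'I_k) : simplex R k x -> i != j ->
  1 <= x i 0 -> 1 <= x j 0 -> False.
Proof.
move=> [x0 x1] ij xi xj; move: x1; rewrite (bigD1 i)//= (bigD1 j)/=; last first.
  by rewrite eq_sym.
have : 0 <= \sum_(l < k | (l != i) && (l != j)) x l 0 by exact: sumr_ge0.
move: (\sum_(_ < k | _) _) => z z0 e.
suff: (1 + 1 : R) <= 1 by rewrite gerDl ler10.
by rewrite -[leRHS]e lerD// ler_wpDr.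
Qed.

Let trivial_vertex i j : trivial_block i (simplex_vertex R j) <-> j = i.
Proof.
have := simplex_vertexP j.
rewrite /trivial_block; case: ifPn => i0 sj; split.
- move=> [_ /(_ j)]; rewrite mxE !eqxx ltxx => H; apply/val_inj/eqP.
  by rewrite (eqP i0); apply: contraT => /H.
- move=> ->; split => // l l0; rewrite mxE andbT ?eqxx.
  by rewrite (_ : l == i = false)//; apply: contraNF l0 => /eqP ->.
- move=> [_] /=; rewrite mxE eqxx andbT.
  by case: eqVneq => // _; rewrite /= ler10.
- by move=> ->; split => //=; rewrite mxE !eqxx.
Qed.

Let trivial_partition : partition [set: 'I_k] trivial_block (simplex R k).
Proof.
split; last by move=> i _; exists (simplex_vertex R i); apply/trivial_vertex.
- apply/seteqP; split => x.
    by move=> [i _]; rewrite /trivial_block; case: ifP => _ [].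
  move=> sx; case: (pselect (exists2 i : 'I_k, val i != 0%N & 1 <= x i 0)).
    by move=> [i i0 xi]; exists i => //; rewrite /trivial_block (negbTE i0).
  move=> /forall2NP H; have k0 : (0 < k)%N.
    rewrite lt0n; apply/eqP => k0; have [_] := sx.
    rewrite big1 => [/esym/eqP|i _]; first by rewrite oner_eq0.
    by have := ltn_ord i; rewrite [X in (_ < X)%N]k0.
  exists (Ordinal k0) => //; rewrite /trivial_block /=; split => // j j0.
  by rewrite ltNge; case: (H j) => // /negP.
- move=> i j _ _ [x []]; rewrite /trivial_block.
  case: ifPn => i0; case: ifPn => j0.
  + by move=> _ _; apply/val_inj; rewrite (eqP i0) (eqP j0).
  + by move=> [_ /(_ j j0) xj] [_ /=]; rewrite leNgt xj.
  + by move=> [_ /= xi] [_ /(_ i i0)]; rewrite ltNge xi.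
  + move=> [sx xi] [_ xj]; apply/eqP; apply: contraT => ij.
    by have := simplex_eq1 sx ij xi xj.
Qed.

Definition trivial_cut : simplex_cut :=
  SimplexCut trivial_partition trivial_polyhedral trivial_vertex.

HB.instance Definition _ := gen_eqMixin simplex_cut.
HB.instance Definition _ := gen_choiceMixin simplex_cut.
HB.instance Definition _ := isPointed.Build simplex_cut trivial_cut.

End SimplexCut.

Section CuttingScheme.
Context (R : realType) (k : nat).

(* Cuts carry the coarsest sigma-algebra for which all crossing numbers are
   random variables. *)
Definition crossing_events : set (set (simplex_cut R k)) :=
  \bigcup_(e in simplex R k `*` simplex R k)
    preimage_set_system [set: simplex_cut R k] (crossing_number e.1 e.2)
      measurable.

Definition cutting_scheme := probability (g_sigma_algebraType crossing_events) R.

Local Open Scope ereal_scope.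

Definition density (P : cutting_scheme) (p q : 'cV[R]_k) : \bar R :=
  (\int[P]_c crossing_number p q c) * ((seg_length p q)^-1)%:E.

Definition max_density (P : cutting_scheme) : \bar R :=
  ereal_sup [set density P e.1 e.2 | e in
    [set e : 'cV[R]_k * 'cV[R]_k |
      [/\ simplex R k e.1, simplex R k e.2 & (0 < seg_length e.1 e.2)%R]]].

Definition min_max_density : \bar R := ereal_inf (range max_density).

End CuttingScheme.

(* Main.v *)
Require Import Defs.
From mathcomp Require Import all_boot all_order all_algebra.
From mathcomp Require Import all_classical all_reals all_analysis.
From mathcomp Require Import measurable_realfun finmap zify ring lra.

                                                                              
                                                                           
                                                                              
                                                                                
                                                                              
                                                                              
                                                                            
                                                                              
                                                                           
                                                                        
             

                                                                            
                                                                               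
                                                                              
                                                                            
                                                                               
                                                                              
                                                                                 
                                                                           
                                                                                         
                                                                            
                                                                            
                                                                    

(** One rounding scheme and one family of instances prove everything.

    Gap at most 12/11. A minimum cut is a cheapest labelling of the nodes by terminals that fixes
    the terminals, so an embedding is rounded by labelling points of the triangle. Take a threshold
    for each coordinate and an order of the terminals; a point gets the first terminal whose
    coordinate exceeds its threshold, and the last one by default. Moving one coordinate across its
    threshold changes the label in at most 4 of the 6 orders, and in at most 3 if both points exceed
    some threshold. Each threshold runs uniformly over a grid of [3m] values. On the lower two
    thirds the three are coupled so that their sum stays below 1; then every point exceeds one of
    them. Weights 4 there and 3 on the top third bound every crossing by 12. The total weight is
    [6 * 11m = 66m], the separations of an edge [e] weigh at most [72m|e| + 36], and [72/66 = 12/11]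
    ([separations_le], [min_cut_cost_le_volume]).

    Lower bounds. A simplex cut labels each node of an embedded instance by its block, and an edge
    with two labels is crossed. Averaging over a scheme gives cut cost at most maximum density times
    volume ([min_cut_cost_le_density]), so instances with ratio tending to 12/11 bound both the
    density and the gap from below. Such an instance is a triangular lattice of side [3n] whose
    three corner triangles (a coordinate above [2n]) are contracted to terminals, leaving a hexagon;
    edges run along lattice lines, with weight [2n] on the sides and 1 elsewhere. Its volume is at
    most [11n] ([lattice_volume]) and its cuts cost at least [12n - 4] ([lattice_min_cut_cost]). For
    the latter, every label class may be assumed connected to its terminal ([connected_labeling]),
    and label changes are counted line by line ([row_changes_sum_ge]). *)

Set Implicit Arguments.
Unset Strict Implicit.
Unset Printing Implicit Defensive.

Import Order.TTheory GRing.Theory Num.Theory.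
Import numFieldNormedType.Exports.

Local Open Scope classical_set_scope.
Local Open Scope ring_scope.

                                       

(** * Cuts as labellings of the nodes *)

Section Labelings.
Context (R : realType) (k : nat) (G : instance R k).

Definition labeling_cost (l : node G -> 'I_k) : R :=
  \sum_e cost e * (l (src e) != l (dst e))%:R.

Lemma cut_cost_ge0 (F : {set edge G}) : 0 <= cut_cost F.
Proof. by apply: sumr_ge0 => e _; exact: cost_ge0. Qed.

Lemma labeling_kway_cut (l : node G -> 'I_k) :
  (forall i, l (terminal G i) = i) ->
  kway_cut (G := G) [set e | l (src e) != l (dst e)]%SET.
Proof.
move=> lt i j ij; apply: contra ij => /connectP[p pp /(congr1 l)].
rewrite lt => ->; rewrite -[X in X == _]lt; apply/eqP.
move: (terminal G i) pp => u; elim: p u => //= v p IHp u /andP[uv /IHp <-].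
case/existsP: uv => e; rewrite inE negbK => /andP[/eqP le].
by case/orP => /andP[/eqP <- /eqP <-].
Qed.

Lemma min_cut_cost_le (l : node G -> 'I_k) :
  (forall i, l (terminal G i) = i) -> min_cut_cost G <= labeling_cost l.
Proof.
move=> /labeling_kway_cut lt; apply: inf_lbound.
  by exists 0 => _ [F _ <-]; exact: cut_cost_ge0.
exists [set e | l (src e) != l (dst e)]%SET => //.
rewrite /cut_cost big_mkcond; apply: eq_bigr => e _.
by rewrite inE; case: ifP => _; rewrite ?mulr1 ?mulr0.
Qed.

(** Label a node by the terminal it still reaches once [F] is removed, or by [i0] if it reaches
    none. The ends of a surviving edge reach the same terminal, so only edges of [F] can change
    label. *)
Lemma kway_cut_labeling (i0 : 'I_k) (F : {set edge G}) : kway_cut (G := G) F ->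
  exists2 l : node G -> 'I_k, (forall i, l (terminal G i) = i) &
    labeling_cost l <= cut_cost F.
Proof.
move=> kF; pose e := adjacent_without F.
have esym : connect_sym e.
  apply: sym_connect_sym => u v; apply: eq_existsb => x; congr (_ && _).
  by rewrite orbC.
have uniq_i i j v : connect e (terminal G i) v -> connect e (terminal G j) v ->
    i = j.
  move=> iv jv; apply/eqP; apply: contraT => /kF; rewrite (connect_trans iv)//.
  by rewrite esym.
pose l v := odflt i0 [pick i | connect e (terminal G i) v].
exists l.
  move=> i; rewrite /l; case: pickP => [j /= ji|/(_ i)]; last first.
    by rewrite connect0.
  exact: uniq_i ji (connect0 _ _).
rewrite /labeling_cost /cut_cost [leRHS]big_mkcond; apply: ler_sum => x _.
case: ifPn => xF; first by rewrite ler_piMr ?cost_ge0// lern1; case: (_ != _).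
rewrite (_ : l (src x) = l (dst x)) ?eqxx ?mulr0// /l.
have exy : connect e (src x) (dst x).
  by apply: connect1; apply/existsP; exists x; rewrite xF !eqxx.
congr odflt; case: pickP => [i /= ix|nx]; case: pickP => [j /= jx|ny] //.
- by congr Some; apply: uniq_i jx; exact: connect_trans ix exy.
- by have := ny i; rewrite (connect_trans ix exy).
- by have := nx j; rewrite (connect_trans jx)// esym.
Qed.

Lemma min_cut_cost_ge (i0 : 'I_k) (c : R) :
  (forall l : node G -> 'I_k, (forall i, l (terminal G i) = i) ->
    c <= labeling_cost l) -> c <= min_cut_cost G.
Proof.
move=> cl; apply: lb_le_inf.
  (* The infimum is over a nonempty set: removing all edges is a cut. *)
  exists (cut_cost [set: edge G]), [set: edge G]%SET => //.
  move=> i j ij; apply: contra ij.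
  move=> /connectP[[_ /= /terminal_inj ->//|v p /=]].
  by case/andP => /existsP[e]; rewrite inE.
move=> _ [F /(kway_cut_labeling i0)[l lt lF] <-].
by apply: le_trans lF; exact: cl.
Qed.

Lemma min_cut_cost_ge0 : 'I_k -> 0 <= min_cut_cost G.
Proof.
move=> i0; apply: (min_cut_cost_ge i0) => l _.
by apply: sumr_ge0 => e _; rewrite mulr_ge0 ?cost_ge0.
Qed.

End Labelings.

                              

(** * Rounding an embedding: the upper bound on the gap *)

Section Orders.

(** The six pairs [(a, d)] enumerate the orders [a, b, c] of the terminals. *)
Definition order_label (a : 'I_3) (d : bool) (X : 'I_3 -> bool) : 'I_3 :=
  let b := if d then ordS a else ord_pred a in
  let c := if d then ord_pred a else ordS a in
  if X a then a else if X b then b else c.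

Definition order_separations (X Y : 'I_3 -> bool) : nat :=
  \sum_a \sum_d (order_label a d X != order_label a d Y).

(** The worst single flip is [{i}] against the empty set: label [i] in every order against the last
    terminal, different in 4 orders. Between nonempty sets the worst is [{i}] against [{i, k}],
    different in 3. All 64 pairs are checked. *)
Lemma order_separations_le (X Y : 'I_3 -> bool) :
  (order_separations X Y <= 4 * \sum_i (X i != Y i))%N /\
  ((exists i, X i) -> (exists i, Y i) ->
    order_separations X Y <= 3 * \sum_i (X i != Y i))%N.
Proof.
pose o (i : nat) : 'I_3 := inord i.
have oE (i : 'I_3) : i = o i by rewrite /o inord_val.
have o0 : ord0 = o 0%N by exact: oE.
have o1 : lift ord0 ord0 = o 1%N by exact: oE.
have o2 : lift ord0 (lift ord0 ord0) = o 2%N by exact: oE.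
have ex (Z : 'I_3 -> bool) : (exists i : 'I_3, Z i) ->
    [|| Z (o 0%N), Z (o 1%N) | Z (o 2%N)].
  by case=> i; rewrite (oE i); case: i => -[|[|[|//]]] i3 ->; rewrite ?orbT.
rewrite /order_separations !big_ord_recl !big_ord0 o2 o1 o0 !big_bool.
rewrite /order_label.
rewrite (oE (ordS (o 0%N))) (oE (ordS (o 1%N))) (oE (ordS (o 2%N))).
rewrite (oE (ord_pred (o 0%N))) (oE (ord_pred (o 1%N))) (oE (ord_pred (o 2%N))).
rewrite /= /o !inordK//= -/o.
have n01 : (o 0%N == o 1%N) = false by rewrite -val_eqE /o /= !inordK.
have n02 : (o 0%N == o 2%N) = false by rewrite -val_eqE /o /= !inordK.
have n12 : (o 1%N == o 2%N) = false by rewrite -val_eqE /o /= !inordK.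
have n := (n01, n02, n12, etrans (eq_sym _ _) n01, etrans (eq_sym _ _) n02,
  etrans (eq_sym _ _) n12).
split.
  by case: (X (o 0%N)); case: (X _); case: (X _); case: (Y _); case: (Y _);
    case: (Y _); rewrite /= ?eqxx ?n.
move=> /ex + /ex.
by case: (X _); case: (X _); case: (X _); case: (Y _); case: (Y _);
    case: (Y _); rewrite /= ?eqxx ?n.
Qed.

End Orders.

Section Thresholds.
Local Open Scope nat_scope.
Variable m : nat.
Hypothesis m_gt0 : (0 < m)%N.

                                                                               
                                                                     
(** Below [2m] the third threshold descends in steps of 2, first through odd and then through even
    numbers, to offset the growth of the other two: the sum is [3m - 1] or [3m - 2], while each
    threshold alone permutes the numbers below [2m]. From [2m] on all three are equal. *)
Definition threshold (j : nat) (i : 'I_3) : nat :=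
  if (2 * m <= j)%N then j else
  match val i with
  | 0 => j
  | 1 => if (j < m)%N then j + m else j - m
  | _ => if (j < m)%N then 2 * m - 1 - 2 * j else 4 * m - 2 - 2 * j
  end.

Lemma threshold_lt j i : (j < 3 * m)%N -> (threshold j i < 3 * m)%N.
Proof.
rewrite /threshold => jm.
by case: i => -[|[|[|//]]] i3 /=; case: (leqP (2 * m)) => ?;
  case: (ltnP j m) => ?; lia.
Qed.

Lemma threshold_sum j : (j < 2 * m)%N -> (\sum_i threshold j i < 3 * m)%N.
Proof.
move=> jm; have jmF : (2 * m <= j) = false by rewrite leqNgt jm.
by rewrite !big_ord_recl big_ord0 /threshold /= jmF; case: (ltnP j m); lia.
Qed.

(** For fixed [i] the threshold is an injection of a finite set into itself, hence a permutation:
    the marginals are uniform in spite of the coupling. *)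
Lemma sum_threshold (i : 'I_3) (h : nat -> nat) :
  \sum_(j < 3 * m) h (threshold j i) = \sum_(j < 3 * m) h j.
Proof.
pose g (j : 'I_(3 * m)) := Ordinal (threshold_lt i (ltn_ord j)).
rewrite [RHS](reindex_inj (h := g))//= => j k /(congr1 val)/=.
move=> E; apply/val_inj; move: E; rewrite /threshold /=.
have [jm km] := (ltn_ord j, ltn_ord k); move: jm km => /=.
case: i {g} => -[|[|[|//]]] i3 /=; do ?[case: leqP => ?]; lia.
Qed.

End Thresholds.

Lemma count_below_bounds (R : realType) (N : nat) (x : R) : 0 <= x ->
  Num.min x N%:R <= (\sum_(j < N) (j%:R < x)%R)%:R <= x + 1.
Proof.
move=> x0; elim: N => [|N IH].
  by rewrite big_ord0 ge_min lexx orbT/= addr_ge0.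
rewrite big_ord_recr/= natrD; move: IH; set c := (\sum_(_ < _) _)%:R.
have cN : c <= N%:R.
  rewrite ler_nat -[leqRHS]card_ord -sum1_card.
  by apply: leq_sum => i _; case: (_ < _).
rewrite -natr1; case: ltP => [Nx|xN] /andP[IH1 IH2] /=.
  by rewrite mulr1n !ge_min in IH1 *; lra.
rewrite mulr0n addr0 IH2 andbT; apply: le_trans IH1.
by rewrite ge_min lexx.
Qed.

Lemma count_between_le (R : realType) (N : nat) (x y : R) : (0 < N)%N ->
  0 <= x <= 1 -> 0 <= y <= 1 ->
  (\sum_(j < N) ((j%:R / N%:R < x) != (j%:R / N%:R < y))%R)%:R
    <= N%:R * `|x - y| + 1.
Proof.
move=> N0; wlog yx : x y / y <= x.
  move=> H x01 y01; case/orP: (le_total y x) => xy; first exact: H.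
  rewrite distrC; under eq_bigr do rewrite eq_sym; exact: H.
move=> /andP[x0 x1] /andP[y0 y1]; rewrite ger0_norm ?subr_ge0//.
have N0' : 0 < N%:R :> R by rewrite ltr0n.
have /andP[_ xN] := @count_below_bounds R N (x * N%:R) (mulr_ge0 x0 (ltW N0')).
have /andP[+ _] := @count_below_bounds R N (y * N%:R) (mulr_ge0 y0 (ltW N0')).
have yN : y * N%:R <= N%:R by rewrite ler_piMl// ltW.
rewrite (min_idPl yN) => {}yN.
suff -> : (\sum_(j < N) ((j%:R / N%:R < x) != (j%:R / N%:R < y))%R)%:R =
    (\sum_(j < N) (j%:R < x * N%:R)%R)%:R -
    (\sum_(j < N) (j%:R < y * N%:R)%R)%:R :> R by lra.
rewrite !natr_sum -sumrB; apply: eq_bigr => j _.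
rewrite !ltr_pdivrMr//; case: ltP => jx; case: ltP => jy /=; lra || idtac.
by have := lt_le_trans jy (le_trans (ler_wpM2r (ltW N0') yx) jx); rewrite ltxx.
Qed.

Section ThresholdRounding.
Context (R : realType) (m : nat).
Hypothesis m_gt0 : (0 < m)%N.

Definition exceeds (j : nat) (x : 'cV[R]_3) (i : 'I_3) : bool :=
  (threshold m j i)%:R / (3 * m)%:R < x i 0.

Lemma order_label_unique (a v : 'I_3) (d : bool) (X : 'I_3 -> bool) :
  (forall i, X i = (i == v)) -> order_label a d X = v.
Proof.
move=> XE; apply/eqP; rewrite /order_label !XE.
by case: a v d {XE} => -[|[|[|//]]] a3 [[|[|[|//]]] v3] [].
Qed.

Lemma exceeds_vertex j (i v : 'I_3) : (j < 3 * m)%N ->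
  exceeds j (simplex_vertex R v) i = (i == v).
Proof.
move=> jm; have m0 : 0 < (3 * m)%:R :> R by rewrite ltr0n muln_gt0.
rewrite /exceeds mxE eqxx andbT; case: eqP => _.
  by rewrite ltr_pdivrMr// mul1r ltr_nat threshold_lt.
by rewrite ltNge divr_ge0// ler0n.
Qed.

(** The coordinates sum to 1 and the scaled thresholds to less than 1. *)
Lemma exceeds_exists j (x : 'cV[R]_3) : (j < 2 * m)%N -> simplex R 3 x ->
  exists i, exceeds j x i.
Proof.
move=> jm [x0 x1]; apply: contrapT => /forallNP H.
have m0 : 0 < (3 * m)%:R :> R by rewrite ltr0n muln_gt0.
suff : (3 * m <= \sum_i threshold m j i)%N by rewrite leqNgt threshold_sum.
rewrite -(ler_nat R) -[leLHS]mul1r -ler_pdivlMr// natr_sum mulr_suml -[leLHS]x1.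
by apply: ler_sum => i _; rewrite leNgt; apply/negP; exact: H.
Qed.

                                                                               
                                     
(** Chosen against the bounds 3 and 4 of [order_separations_le]: weight times separations is at most
    12 per changed indicator on both ranges. *)
Definition threshold_weight (j : nat) : nat := if (j < 2 * m)%N then 4 else 3.

Lemma threshold_weight_sum : (\sum_(j < 3 * m) threshold_weight j = 11 * m)%N.
Proof.
have -> : (3 * m = 2 * m + m)%N by lia.
rewrite big_split_ord/= (eq_bigr (fun=> 4%N)) => [|i _]; last first.
  by rewrite /threshold_weight ltn_ord.
rewrite [X in (_ + X)%N](eq_bigr (fun=> 3%N)) => [|i _]; last first.
  by rewrite /threshold_weight ltnNge leq_addr.
by rewrite !sum_nat_const !card_ord; lia.
Qed.

(** Coordinate [i] contributes [12 * (3m |x_i - y_i| + 1)], and the differences sum to twice the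
    segment length. *)
Lemma separations_le (x y : 'cV[R]_3) : simplex R 3 x -> simplex R 3 y ->
  (\sum_(j < 3 * m)
     threshold_weight j * order_separations (exceeds j x) (exceeds j y))%:R
  <= 72 * m%:R * seg_length x y + 36.
Proof.
move=> xS yS; pose h i (t : nat) : nat :=
  ((t%:R / (3 * m)%:R < x i 0) != (t%:R / (3 * m)%:R < y i 0)).
have le01 (z : 'cV[R]_3) i : simplex R 3 z -> 0 <= z i 0 <= 1.
  move=> [z0 <-]; rewrite z0 (bigD1 i)//= lerDl; exact: sumr_ge0.
have m0 : (0 < 3 * m)%N by rewrite muln_gt0.
apply: (@le_trans _ _ (12 * \sum_i \sum_(j < 3 * m) h i j)%:R).
  have -> : (\sum_i \sum_(j < 3 * m) h i j =
             \sum_(j < 3 * m) \sum_i h i (threshold m j i))%N.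
    rewrite [RHS]exchange_big/=; apply: eq_bigr => i _.
    by rewrite (sum_threshold m_gt0).
  rewrite ler_nat big_distrr/=; apply: leq_sum => j _.
  have [H4 H3] := order_separations_le (exceeds j x) (exceeds j y).
  rewrite /threshold_weight; case: ifPn => jm.
    have := H3 (exceeds_exists jm xS) (exceeds_exists jm yS).
    by rewrite -[12%N]/(4 * 3)%N -mulnA leq_mul2l.
  by rewrite -[12%N]/(3 * 4)%N -mulnA leq_mul2l.
rewrite natrM natr_sum.
have -> : 72 * m%:R * seg_length x y + 36 =
    12 * \sum_i ((3 * m)%:R * `|x i 0 - y i 0| + 1).
  by rewrite /seg_length !big_ord_recl !big_ord0 natrM; field.
rewrite ler_pM2l ?ltr0n//; apply: ler_sum => i _.
by apply: count_between_le => //; exact: le01.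
Qed.

End ThresholdRounding.

Section Rounding.
Context (R : realType) (G : instance R 3) (f : node G -> 'cV[R]_3).
Hypothesis fE : embedding (G := G) f.

(** Each pair of threshold index and order yields a cut; [66m] is the total weight, [11m] for each
    of the six orders. *)
Lemma min_cut_cost_le_volumeD (m : nat) : (0 < m)%N ->
  66 * m%:R * min_cut_cost G <=
  \sum_e cost e * (72 * m%:R * seg_length (f (src e)) (f (dst e)) + 36).
Proof.
move=> m0; have [fS fT] := fE.
pose l j a d v := order_label a d (exceeds m j (f v)).
apply: (@le_trans _ _ (\sum_(j < 3 * m) \sum_(a < 3) \sum_d
    (threshold_weight m j)%:R * labeling_cost (l j a d))).
  apply: (@le_trans _ _ (\sum_(j < 3 * m) \sum_(a < 3) \sum_(d : bool)
    (threshold_weight m j)%:R * min_cut_cost G)).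
    rewrite [leRHS](eq_bigr (fun j : 'I_(3 * m) =>
      (threshold_weight m j)%:R * (6 * min_cut_cost G))) => [|j _]; last first.
      rewrite !sumr_const card_ord card_bool -mulrnA -[LHS]mulr_natr natrM.
      by ring.
    by rewrite -mulr_suml -natr_sum threshold_weight_sum// natrM; lra.
  apply: ler_sum => j _; apply: ler_sum => a _; apply: ler_sum => d _.
  rewrite ler_wpM2l ?ler0n//; apply: min_cut_cost_le => i; rewrite /l fT.
  by apply: order_label_unique => k; exact: exceeds_vertex.
rewrite /labeling_cost.
under eq_bigr do under eq_bigr do under eq_bigr do rewrite mulr_sumr.
under eq_bigr do under eq_bigr do rewrite exchange_big/=.
under eq_bigr do rewrite exchange_big/=.
rewrite exchange_big/=; apply: ler_sum => e _.
apply: le_trans (ler_wpM2l (cost_ge0 e)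
  (separations_le m0 (fS (src e)) (fS (dst e)))).
rewrite le_eqVlt; apply/orP; left; apply/eqP.
rewrite natr_sum mulr_sumr; apply: eq_bigr => j _.
rewrite natrM mulrCA /order_separations natr_sum !mulr_sumr.
apply: eq_bigr => a _; rewrite natr_sum !mulr_sumr; apply: eq_bigr => d _.
by [].
Qed.

(** Divide the previous bound by [66m]; the error, 36 times the total edge cost, disappears as [m]
    grows. *)
Lemma min_cut_cost_le_volume : min_cut_cost G <= 12 / 11 * volume f.
Proof.
rewrite leNgt; apply/negP => lt.
pose C : R := \sum_(e : edge G) cost e.
have C0 : 0 <= C by apply: sumr_ge0 => e _; exact: cost_ge0.
pose d := 66 * min_cut_cost G - 72 * volume f.
have d0 : 0 < d by rewrite /d; lra.
have H m : (0 < m)%N -> m%:R * d <= 36 * C.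
  move=> /min_cut_cost_le_volumeD; rewrite /d mulrBr.
  under eq_bigr do rewrite mulrDr mulrCA.
  by rewrite big_split/= -mulr_sumr -mulr_suml -/(volume f) -/C; lra.
have := H (Num.truncn (36 * C / d)).+1 isT.
by rewrite leNgt -ltr_pdivrMr// truncnS_gt.
Qed.

End Rounding.

                                             

(** * Cutting schemes applied to embedded instances *)

Section Crossings.
Context (R : realType) (k : nat).
Implicit Types (c : simplex_cut R k.+1) (p q : 'cV[R]_k.+1).

Lemma segment_connected p q : connected (segment p q).
Proof.
rewrite /segment.
have -> : [set p + t *: (q - p) | t in [set t : R | 0 <= t <= 1]] =
    (fun t : R => p + t *: (q - p)) @` `[0, 1].
  by congr (image _ _); apply/seteqP; split => t /=; rewrite in_itv.
apply: connected_continuous_connected; first exact: segment_connected.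
apply: continuous_subspaceT => t.
by apply: cvgD; [exact: cvg_cst|exact: scalel_continuous].
Qed.

Lemma segment_left p q : segment p q p.
Proof. by exists 0; rewrite /= ?lexx ?ler01// scale0r addr0. Qed.

Lemma segment_right p q : segment p q q.
Proof. by exists 1; rewrite /= ?lexx ?ler01// scale1r addrC subrK. Qed.

Lemma block_unique c i j x : block c i x -> block c j x -> i = j.
Proof.
have [_ tI _] := block_partition c => ix jx.
by apply: (tI i j) => //; exists x.
Qed.

(** Without crossings every point of the segment has a neighbourhood inside one block, so the trace
    of block [i] is open and closed in a connected set; it would then contain [q]. *)
Lemma crossing_number_ge1 c p q i j : block c i p -> block c j q -> i != j ->
  (1%:E <= crossing_number p q c)%E.
Proof.
move=> ip jq ij.
have [x xc] : crossings c p q !=set0.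
  apply/set0P; apply: contra ij => /eqP cr0.
  have near_block x : segment p q x ->
      exists l, \forall y \near x, segment p q y -> block c l y.
    move=> xs; apply: contrapT => /forallNP H.
    have : crossings c p q x by split=> // l; exact: H.
    by rewrite cr0.
  suff E : segment p q `&` block c i = segment p q.
    have [_ iq] : (segment p q `&` block c i) q.
      by rewrite E; exact: segment_right.
    by apply/eqP; exact: block_unique jq.
  apply: (@segment_connected p q).
  - by exists p; split => //; exact: segment_left.
  - exists (interior [set y | segment p q y -> block c i y]).
      exact: open_interior.
    apply/seteqP; split => x [xs ix]; split => //; last first.
      exact: (interior_subset ix).
    have [l lx] := near_block _ xs.
    have il := block_unique ix (nbhs_singleton lx xs).
    by rewrite /interior /= il.
  - exists (~` interior [set y | segment p q y -> ~ block c i y]).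
      by apply: open_closedC; exact: open_interior.
    apply/seteqP; split => x [xs ix]; split => //.
      by move=> /interior_subset /(_ xs).
    have [l lx] := near_block _ xs.
    apply: contrapT => nix; apply: ix; rewrite /interior /=.
    have blx := nbhs_singleton lx xs.
    apply: filterS lx => y ly ys iy; apply: nix.
    by rewrite (block_unique iy (ly ys)).
rewrite /crossing_number /counting; case: asboolP => [fc|_]; last exact: leey.
rewrite lee_fin ler1n lt0n; apply/negP => /[!cardfs_eq0]/eqP E.
have : x \in fset_set (crossings c p q) by rewrite in_fset_set// mem_set.
by rewrite E.
Qed.

End Crossings.

Section SchemeBound.
Context (R : realType) (k : nat).

Lemma measurable_crossing_number (p q : 'cV[R]_k) :
  simplex R k p -> simplex R k q ->
  measurable_fun [set: g_sigma_algebraType (@crossing_events R k)]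
    (crossing_number p q :
      g_sigma_algebraType (@crossing_events R k) -> \bar R).
Proof.
move=> ps qs _ Y mY; apply: sub_sigma_algebra.
by exists (p, q) => //; exists Y.
Qed.

Lemma crossing_number_ge0 (p q : 'cV[R]_k) c : (0 <= crossing_number p q c)%E.
Proof.
by rewrite /crossing_number /counting; case: asboolP; rewrite ?lee_fin ?leey.
Qed.

Lemma seg_length_ge0 (p q : 'cV[R]_k) : 0 <= seg_length p q.
Proof. by rewrite mulr_ge0 ?invr_ge0 ?ler0n// sumr_ge0. Qed.

Lemma seg_length_eq0 (p q : 'cV[R]_k) : (seg_length p q == 0) = (p == q).
Proof.
rewrite mulf_eq0 invr_eq0 pnatr_eq0/= psumr_eq0//.
apply/allP/eqP => [H|-> i _]; last by rewrite /= subrr normr0.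
apply/matrixP => i j; rewrite ord1; apply/eqP.
by rewrite -subr_eq0 -normr_eq0; apply: (H i); rewrite mem_index_enum.
Qed.

End SchemeBound.

Section SchemeLowerBound.
Context (R : realType) (k : nat) (G : instance R k.+1).
Variables (f : node G -> 'cV[R]_k.+1) (P : cutting_scheme R k.+1).
Hypothesis fE : embedding (G := G) f.
Local Open Scope ereal_scope.

(** Label each node by the block of its image. Edges of length zero are left out, since densities
    concern positive lengths only; their ends share a block. *)
Lemma min_cut_cost_le_crossings (c : simplex_cut R k.+1) :
  (min_cut_cost G)%:E <= \sum_(e | f (src e) != f (dst e))
    (cost e)%:E * crossing_number (f (src e)) (f (dst e)) c.
Proof.
have [fS fT] := fE; have [cU _ _] := block_partition c.
have /choice[l bl] v : exists i, block c i (f v).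
  by have := fS v; rewrite -cU => -[i _ bi]; exists i.
have lT i : l (terminal G i) = i.
  by apply/esym/(block_vertex c); rewrite -fT.
apply: le_trans (_ : (labeling_cost l)%:E <= _).
  by rewrite lee_fin; exact: min_cut_cost_le.
rewrite /labeling_cost (bigID (fun e => f (src e) != f (dst e)))/=.
rewrite [X in (_ + X)%R]big1 ?addr0 => [|e /negPn/eqP fe]; last first.
  rewrite (_ : l (src e) = l (dst e)) ?eqxx ?mulr0//.
  by apply: (@block_unique _ _ c _ _ (f (src e))); rewrite // fe.
rewrite -sumEFin; apply: lee_sum => e _; rewrite EFinM.
have cost0 : 0 <= (cost e)%:E by rewrite lee_fin cost_ge0.
have [_|le] := eqVneq (l (src e)) (l (dst e)).
  by rewrite mule0 mule_ge0// crossing_number_ge0.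
rewrite lee_wpmul2l//; apply: crossing_number_ge1 le; exact: bl.
Qed.

Lemma min_cut_cost_le_density :
  (min_cut_cost G)%:E <= max_density P * (volume f)%:E.
Proof.
have [fS fT] := fE.
have f0 e c : 0 <= (cost e)%:E * crossing_number (f (src e)) (f (dst e)) c.
  by rewrite mule_ge0 ?lee_fin ?cost_ge0 ?crossing_number_ge0.
have mf e : measurable_fun [set: g_sigma_algebraType (@crossing_events R k.+1)]
    (fun c => (cost e)%:E * crossing_number (f (src e)) (f (dst e)) c).
  by apply: measurable_funeM; exact: measurable_crossing_number.
pose es := [seq e <- index_enum (edge G) | f (src e) != f (dst e)].
apply: (@le_trans _ _ (\int[P]_c \sum_(e <- es)
    (cost e)%:E * crossing_number (f (src e)) (f (dst e)) c)).
  rewrite -[leLHS]mule1 -(@probability_setT _ _ _ P) -integral_cst//.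
  apply: ge0_le_integral => //.
  - by move=> c _; rewrite lee_fin; exact: min_cut_cost_ge0 ord0.
  - by apply: emeasurable_sum.
  - by move=> c _; rewrite /es big_filter; exact: min_cut_cost_le_crossings.
rewrite ge0_integral_sum// /es big_filter.
have -> : (volume f)%:E = \sum_(e | f (src e) != f (dst e))
    (cost e * seg_length (f (src e)) (f (dst e)))%:E.
  rewrite sumEFin /volume [in LHS](bigID (fun e => f (src e) != f (dst e)))/=.
  rewrite [X in (_ + X)%R]big1 ?addr0// => e /negPn; rewrite -seg_length_eq0.
  by move/eqP => ->; rewrite mulr0.
rewrite ge0_sume_distrr => [|e _]; last first.
  by rewrite lee_fin mulr_ge0 ?cost_ge0 ?seg_length_ge0.
apply: lee_sum => e fe; rewrite ge0_integralZl//; last first.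
- by rewrite lee_fin cost_ge0.
- by move=> c _; exact: crossing_number_ge0.
- exact: measurable_crossing_number.
rewrite EFinM muleCA lee_wpmul2l ?lee_fin ?cost_ge0//.
have len0 : (0 < seg_length (f (src e)) (f (dst e)))%R.
  by rewrite lt_neqAle seg_length_ge0 andbT eq_sym seg_length_eq0.
rewrite -lee_pdivrMr//; apply: ereal_sup_ubound.
by exists (f (src e), f (dst e)) => //; split => /=.
Qed.

End SchemeLowerBound.

                                          

(** * Connected labellings, and multigraphs as instances *)

Section Multigraph.
Context (V M : finType) (s d : M -> V).

Definition edge_between (u v : V) (m : M) : bool :=
  ((s m == u) && (d m == v)) || ((s m == v) && (d m == u)).

Lemma edge_betweenC u v m : edge_between u v m = edge_between v u m.
Proof. exact: orbC. Qed.

Definition adjacent_in (T : eqType) (l : V -> T) : rel V :=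
  fun u v => (l u == l v) && [exists m, edge_between u v m].

Lemma adjacent_in_sym (T : eqType) (l : V -> T) : connect_sym (adjacent_in l).
Proof.
apply: sym_connect_sym => u v; rewrite /adjacent_in eq_sym; congr (_ && _).
by apply: eq_existsb => m; exact: edge_betweenC.
Qed.

Section Connected.
Context (k : nat) (w : M -> nat) (t : 'I_k -> V).
Implicit Types l : V -> 'I_k.

Definition weighted_changes l : nat := \sum_m w m * (l (s m) != l (d m)).

Definition at_terminal l (v : V) := connect (adjacent_in l) (t (l v)) v.

Lemma connect_adjacent_in l u v : connect (adjacent_in l) u v -> l u = l v.
Proof.
move=> /connectP[p + ->]; elim: p u => //= x p IHp u /andP[/andP[/eqP -> _]].
exact: IHp.
Qed.

Lemma first_exit (e : rel V) (A : pred V) u v :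
  A u -> ~~ A v -> connect e u v -> exists x y, [/\ A x, ~~ A y & e x y].
Proof.
move=> + + /connectP[p + vE]; rewrite {}vE.
elim: p u => [|x p IHp] u Au /=; first by rewrite Au.
move=> Al /andP[eux px]; case: (boolP (A x)) => Ax; first exact: IHp px.
by exists u, x.
Qed.

Definition relabel l (y : V) (c : 'I_k) : V -> 'I_k :=
  fun x => if connect (adjacent_in l) y x then c else l x.

(** An edge whose ends had equal labels lies entirely inside or outside the recoloured component, so
    it still has equal labels; every other edge was already counted. *)
Lemma relabel_changes l y (c : 'I_k) :
  (weighted_changes (relabel l y c) <= weighted_changes l)%N.
Proof.
apply: leq_sum => m _; rewrite leq_mul2l /relabel; apply/orP; right.
have [lE|lE] := eqVneq (l (s m)) (l (d m)); last by case: (_ != _).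
have -> : connect (adjacent_in l) y (s m) = connect (adjacent_in l) y (d m).
  apply: (same_connect_r (adjacent_in_sym l)); apply: connect1.
  rewrite /adjacent_in lE eqxx; apply/existsP; exists m.
  by rewrite /edge_between !eqxx.
by case: ifP; rewrite ?lE eqxx.
Qed.

                                                                               
                            
(** Induction on the number of nodes not joined to their terminal inside their class: a component
    cut off from its terminal takes the label of an attached neighbour. *)
Lemma connected_labeling (i0 : 'I_k) l : (forall i, l (t i) = i) ->
  exists l', [/\ forall i, l' (t i) = i,
    (weighted_changes l' <= weighted_changes l)%N &
    forall v, connect (adjacent_in (fun=> tt)) (t i0) v -> at_terminal l' v].
Proof.
have [n] := ubnP #|[pred v | ~~ at_terminal l v]|.
elim: n l => // n IHn l; rewrite ltnS => ln lt.
have tg i : at_terminal l (t i) by rewrite /at_terminal lt connect0.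
have [/forallP H|] := boolP [forall v,
    connect (adjacent_in (fun=> tt)) (t i0) v ==> at_terminal l v].
  by exists l; split=> // v; exact/implyP.
rewrite negb_forall => /existsP[v]; rewrite negb_imply => /andP[cv nv].
(* A path to [v] leaves the attached nodes along some edge [xy]; giving the component of [y] the
   label of [x] attaches [y]. *)
have [x [y [tx nty /andP[_ /existsP[m xym]]]]] := first_exit (tg i0) nv cv.
pose l1 := relabel l y (l x).
have yF z : at_terminal l z -> connect (adjacent_in l) y z = false.
  move=> tz; apply: contraNF nty => yz; rewrite /at_terminal.
  by rewrite (connect_adjacent_in yz) (connect_trans tz)// adjacent_in_sym.
have l1E z : at_terminal l z -> l1 z = l z.
  by move=> /yF E; rewrite /l1 /relabel E.
(* Attached nodes keep their labels, so paths from terminals inside a class survive the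
   recolouring. *)
have walk p u : path (adjacent_in l) u p -> at_terminal l u ->
    connect (adjacent_in l1) u (last u p).
  elim: p u => [|a p IHp] u /=; first by rewrite connect0.
  move=> /andP[ua ap] tu; have [/eqP la _] := andP ua.
  have ta : at_terminal l a.
    by rewrite /at_terminal -la (connect_trans tu) ?connect1.
  apply: connect_trans (IHp a ap ta); apply: connect1.
  by move: ua; rewrite /adjacent_in !l1E.
have sub z : at_terminal l z -> at_terminal l1 z.
  move=> tz; rewrite /at_terminal l1E//.
  by case/connectP: (tz) => p pp {2}->; exact: walk.
have ty : at_terminal l1 y.
  have l1y : l1 y = l x by rewrite /l1 /relabel connect0.
  have := sub _ tx; rewrite /at_terminal l1E// l1y => /connect_trans; apply.
  apply: connect1; rewrite /adjacent_in l1y l1E// eqxx.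
  by apply/existsP; exists m.
have [||l2 [l2t l2l l2c]] := IHn l1.
- apply: leq_trans ln; apply: proper_card; apply/fintype.properP; split.
    by apply/fintype.subsetP => z; rewrite !inE; apply: contra; exact: sub.
  by exists y; rewrite !inE ?nty ?ty.
- by move=> i; rewrite l1E.
- by exists l2; split=> //; apply: leq_trans l2l _; exact: relabel_changes.
Qed.

End Connected.
End Multigraph.

Section SimpleGraph.
Context (R : realType) (k : nat) (V M : finType) (s d : M -> V) (w : M -> nat).
Variable t : 'I_k -> V.
Hypothesis t_inj : injective t.

(** Instances forbid loops and parallel edges, which lattice lines produce: loops are dropped and
    parallel edges merged with their weights added. Comparing [enum_rank] keeps one orientation per
    pair. *)
Definition simple_edge : finType := {p : V * V |
  (enum_rank p.1 < enum_rank p.2)%N && [exists m, edge_between s d p.1 p.2 m]}.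
Implicit Type e : simple_edge.
Let esrc e := (val e).1.
Let edst e := (val e).2.

Let simple_no_loop e : esrc e != edst e.
Proof.
have /andP[+ _] := valP e; apply: contraTN => /eqP E.
by rewrite -/(esrc e) E ltnn.
Qed.

Let simple_no_parallel : injective (fun e => [set esrc e; edst e]%SET).
Proof.
move=> [[a b] /= abP] [[a' b'] /= abP'] E; apply/val_inj => /=.
move: (abP) (abP') => /andP[/= ab _] /andP[/= ab' _].
have := set21 a b; have := set22 a b; rewrite E !inE.
move=> /orP[]/eqP bE /orP[]/eqP aE; move: ab; rewrite ?bE ?aE ?ltnn//.
by move=> /(ltn_trans ab'); rewrite ltnn.
Qed.

Let simple_cost e : R :=
  (\sum_(m | edge_between s d (esrc e) (edst e) m) w m)%:R.

Definition simple_instance : instance R k :=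
  @Instance R k V simple_edge esrc edst simple_no_loop simple_no_parallel
    simple_cost (fun e => ler0n _ _) t t_inj.

Lemma sum_simple_instance (g : V -> V -> R) :
  (forall u v, g u v = g v u) -> (forall v, g v v = 0) ->
  \sum_(e : edge simple_instance) cost e * g (src e) (dst e) =
  \sum_m (w m)%:R * g (s m) (d m).
Proof.
move=> gC g0; rewrite /= /simple_cost.
under eq_bigr do rewrite natr_sum mulr_suml big_mkcond/=.
rewrite exchange_big/=; apply: eq_bigr => m _; rewrite -big_mkcond/=.
have gE e : edge_between s d (esrc e) (edst e) m ->
    g (esrc e) (edst e) = g (s m) (d m).
  by case/orP => /andP[/eqP <- /eqP <-].
under eq_bigr => e /gE -> do over.
have [sd|sd] := eqVneq (s m) (d m).
  by rewrite sd g0 mulr0 big1.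
pose p := if (enum_rank (s m) < enum_rank (d m))%N then (s m, d m)
          else (d m, s m).
have pE : edge_between s d p.1 p.2 m.
  by rewrite /p /edge_between; case: ifP => _; rewrite /= !eqxx ?orbT.
have pP : (enum_rank p.1 < enum_rank p.2)%N &&
    [exists m, edge_between s d p.1 p.2 m].
  apply/andP; split; last by apply/existsP; exists m.
  rewrite /p; case: ifPn => //=; rewrite -leqNgt leq_eqVlt => /orP[|//].
  by move=> /eqP/val_inj/enum_rank_inj ds; rewrite ds eqxx in sd.
rewrite (big_pred1 (Sub p pP))// => e; apply/idP/eqP => [|->//].
have /andP[lt _] := valP e.
move=> /orP[]/andP[/eqP sE /eqP dE]; apply/val_inj; rewrite /= /p sE dE.
  by rewrite [(_ < _)%N]lt; exact: surjective_pairing.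
by rewrite ltnNge [(_ <= _)%N](ltnW lt); exact: surjective_pairing.
Qed.

End SimpleGraph.

(** * Changes along a sequence, and cyclic indices modulo 3 *)

Section Changes.
Context (T : eqType) (f : nat -> T).
Local Open Scope nat_scope.

Definition changes (a b : nat) : nat := \sum_(a <= j < b) (f j != f j.+1).

Lemma changes_cat a b c : a <= b <= c ->
  changes a c = changes a b + changes b c.
Proof. by move=> /andP[ab bc]; rewrite /changes (@big_cat_nat _ _ _ b). Qed.

Lemma changes_ge1 a b : a <= b -> f a != f b -> 0 < changes a b.
Proof.
elim: b => [|b IHb]; first by rewrite leqn0 => /eqP ->; rewrite eqxx.
rewrite leq_eqVlt => /orP[/eqP ->|]; first by rewrite eqxx.
rewrite ltnS => ab fab; rewrite /changes big_nat_recr//=.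
have [fb|fb] := eqVneq (f a) (f b); first by rewrite -fb fab addn_gt0 orbT.
by rewrite addn_gt0 IHb.
Qed.

Lemma changes_ge2 a j b : a <= j <= b -> f j != f a -> f j != f b ->
  1 < changes a b.
Proof.
move=> /[dup] ajb /andP[aj jb] fa fb; rewrite (changes_cat ajb).
have := changes_ge1 aj; have := changes_ge1 jb.
by rewrite [f a == _]eq_sym fa fb => /(_ isT) + /(_ isT); lia.
Qed.

Lemma changes_cases b : f 0 != f b ->
  [\/ exists2 u, u < b & forall j, j <= b -> f j = if j <= u then f 0 else f b,
     (exists2 j, j <= b & (f j != f 0) && (f j != f b)) /\ 1 < changes 0 b |
     2 < changes 0 b].
Proof.
move=> f0b; have ex : exists j, f j != f 0 by exists b; rewrite eq_sym.
case: (ex_minnP ex) => -[|u] fu umin; first by rewrite eqxx in fu.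
have ub : u < b by apply: umin; rewrite eq_sym.
have f0u j : j <= u -> f j = f 0.
  by move=> ju; apply/eqP; apply: contraT => /umin; rewrite ltnNge ju.
have [fub|fub] := eqVneq (f u.+1) (f b); last first.
  constructor 2; split; first by exists u.+1; rewrite ?fu.
  by apply: changes_ge2 fu fub.
case: (pselect (exists2 j, u < j <= b & f j != f b)) => [[j /andP[uj jb] fj]|].
  constructor 3; rewrite (@changes_cat 0 u.+1)//.
  have := @changes_ge1 0 u.+1 isT; rewrite eq_sym fu => /(_ isT).
  have := @changes_ge2 u.+1 j b; rewrite uj jb fub fj => /(_ isT isT isT).
  by lia.
move=> H; constructor 1; exists u => // j jb; case: leqP => [/f0u//|uj].
by apply/eqP; apply: contraT => fj; case: H; exists j => //; rewrite uj.
Qed.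

End Changes.

Lemma sum_interval_ge (p q c : nat) : (q <= c)%N ->
  (q - p <= \sum_(s < c) (p <= s < q))%N.
Proof.
elim: c q => [|c IHc] q; first by rewrite leqn0 => /eqP ->.
rewrite big_ord_recr/= leq_eqVlt => /orP[/eqP ->|].
  have -> : (\sum_(s < c) (p <= s < c.+1) = \sum_(s < c) (p <= s < c))%N.
    by apply: eq_bigr => s _; have sc := ltn_ord s; rewrite sc ltnS (ltnW sc).
  by rewrite ltnSn andbT; have := IHc c (leqnn c); case: (leqP p c) => /=; lia.
by rewrite ltnS => /[dup] qc /IHc; rewrite [(c < q)%N]ltnNge qc andbF addn0.
Qed.

Section Cyclic.
Implicit Types i k : 'I_3.

Lemma ordS3 i : ordS (ordS (ordS i)) = i.
Proof. by apply/val_inj; case: i => -[|[|[|//]]]. Qed.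

Lemma ordS_neq i :
  [/\ ordS i != i, ordS (ordS i) != i & ordS (ordS i) != ordS i].
Proof. by case: i => -[|[|[|//]]]. Qed.

Lemma ordS_eqF i :
  (((ordS i == i) = false) * ((i == ordS i) = false) *
   ((ordS (ordS i) == i) = false) * ((i == ordS (ordS i)) = false) *
   ((ordS (ordS i) == ordS i) = false) *
   ((ordS i == ordS (ordS i)) = false))%type.
Proof. by case: i => -[|[|[|//]]]. Qed.

Lemma ordS_cases i k : [\/ k = i, k = ordS i | k = ordS (ordS i)].
Proof.
by case: i k => -[|[|[|//]]] i3 [[|[|[|//]]] k3];
  (constructor 1; exact/val_inj) || (constructor 2; exact/val_inj) ||
  (constructor 3; exact/val_inj).
Qed.

Lemma sum_ordS (g : 'I_3 -> nat) i :
  (\sum_k g k = g i + g (ordS i) + g (ordS (ordS i)))%N.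
Proof.
have [n1 n2 n3] := ordS_neq i.
rewrite (bigD1 i)//= (bigD1 (ordS i))//= (bigD1 (ordS (ordS i)))/=; last first.
  by rewrite n2 n3.
rewrite big1 ?addn0 ?addnA// => k /andP[/andP[k1 k2] k3].
by case: (ordS_cases i k) k1 k2 k3 => ->; rewrite eqxx.
Qed.

End Cyclic.

                               

(** * The contracted triangular lattice *)

Section Lattice.
Variable n : nat.
Hypothesis n_gt0 : (0 < n)%N.
Local Open Scope nat_scope.

                                                                                
                                                                                
(** The whole cube is taken for convenience; only the corners and the hexagon points of the plane
    with coordinate sum [3n] lie on lines. *)
Definition lattice_node : finType := {ffun 'I_3 -> 'I_(3 * n).+1}.

Definition lattice_coord (v : lattice_node) (k : 'I_3) : nat := v k.

Definition lattice_point (g : 'I_3 -> nat) : lattice_node :=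
  [ffun k => inord (g k)].

Definition corner (i : 'I_3) : lattice_node :=
  lattice_point (fun k => if k == i then 3 * n else 0).

Definition line_coord (i : 'I_3) (s j : nat) (k : 'I_3) : nat :=
  if k == i then s else if k == ordS i then 3 * n - s - j else j.

                                                                             
                                            
(** The lattice line where coordinate [i] is [s], with the corner triangles contracted: for [s < n]
    it runs from corner [ordS i] to corner [ordS (ordS i)]. Clamping [j] gives all lines the index
    range up to [3n], at the price of loops. *)
Definition line (i : 'I_3) (s j : nat) : lattice_node :=
  let j := minn j (3 * n - s) in
  if 2 * n < 3 * n - s - j then corner (ordS i) else
  if 2 * n < j then corner (ordS (ordS i)) else
  lattice_point (line_coord i s j).

Definition in_hexagon (v : lattice_node) : bool :=
  (\sum_k lattice_coord v k == 3 * n) && [forall k, lattice_coord v k <= 2 * n].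

Lemma lattice_pointE g k : g k <= 3 * n ->
  lattice_coord (lattice_point g) k = g k.
Proof. by move=> gk; rewrite /lattice_coord ffunE inordK. Qed.

Lemma cornerE i k : lattice_coord (corner i) k = if k == i then 3 * n else 0.
Proof. by rewrite lattice_pointE//; case: ifP. Qed.

Lemma corner_inj : injective corner.
Proof.
move=> i k /(congr1 (lattice_coord ^~ i)); rewrite !cornerE eqxx.
by case: eqP => // _; lia.
Qed.

Lemma lattice_point_ext g h : (forall k, g k = h k) ->
  lattice_point g = lattice_point h.
Proof. by move=> gh; apply/ffunP => k; rewrite !ffunE gh. Qed.

Lemma line_left i s : s < n -> line i s 0 = corner (ordS i).
Proof. by move=> sn; rewrite /line min0n subn0 ifT//; lia. Qed.

Lemma line_right i s : s < n -> line i s (3 * n) = corner (ordS (ordS i)).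
Proof.
move=> sn; rewrite /line (minn_idPr _) ?leq_subr//.
by rewrite ifN ?ifT//; lia.
Qed.

(** Lines end on the two other sides, which are themselves lines of level 0; hence the labels on the
    sides determine those at the line ends. *)
Lemma line_left_side i s : s <= 2 * n ->
  line i s 0 = line (ordS (ordS i)) 0 (3 * n - s).
Proof.
move=> sn.
rewrite /line min0n !subn0 (minn_idPl _) ?leq_subr// ordS3.
have -> : (2 * n < 3 * n - (3 * n - s)) = false by lia.
case: ltnP => // sn'.
apply: lattice_point_ext => k; rewrite /line_coord ordS3 !subn0.
by case: (ordS_cases i k) => ->; rewrite ?(eqxx, ordS_eqF); lia.
Qed.

Lemma line_right_side i s : s <= 2 * n ->
  line i s (3 * n) = line (ordS i) 0 s.
Proof.
move=> sn; rewrite /line !subn0 (minn_idPr _) ?leq_subr//.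
rewrite (minn_idPl _); last by lia.
rewrite ifN; last by lia.
case: ltnP => // sn'.
rewrite ifN; last by lia.
apply: lattice_point_ext => k; rewrite /line_coord !subn0.
by case: (ordS_cases i k) => ->; rewrite ?(eqxx, ordS_eqF); lia.
Qed.

Lemma lattice_coord_inj (u v : lattice_node) :
  lattice_coord u =1 lattice_coord v -> u = v.
Proof. by move=> uv; apply/ffunP => k; apply/val_inj; exact: uv. Qed.

Lemma hexagon_line (v : lattice_node) i : in_hexagon v ->
  v = line i (lattice_coord v i) (lattice_coord v (ordS (ordS i))).
Proof.
move=> /andP[/eqP + /forallP v2]; rewrite (sum_ordS _ i) => vS.
have := v2 i; have := v2 (ordS i); have := v2 (ordS (ordS i)) => h2 h1 h0.
rewrite /line (minn_idPl _); last by lia.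
rewrite ifN; last by lia.
rewrite ifN; last by lia.
apply: lattice_coord_inj => k; rewrite lattice_pointE /line_coord;
  case: (ordS_cases i k) => ->; rewrite ?(eqxx, ordS_eqF); lia.
Qed.

Variant line_spec i s j : lattice_node -> Type :=
| LineLeft of s + j < n : line_spec i s j (corner (ordS i))
| LineRight of 2 * n < j : line_spec i s j (corner (ordS (ordS i)))
| LineMiddle of in_hexagon (lattice_point (line_coord i s j)) &
    lattice_coord (lattice_point (line_coord i s j)) i = s &
    lattice_coord (lattice_point (line_coord i s j)) (ordS i) = 3 * n - s - j &
    lattice_coord (lattice_point (line_coord i s j)) (ordS (ordS i)) = j :
    line_spec i s j (lattice_point (line_coord i s j)).

Lemma lineP i s j : s <= 2 * n -> j <= 3 * n - s ->
  line_spec i s j (line i s j).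
Proof.
move=> s2 js; rewrite /line (minn_idPl js); case: ltnP => h1.
  by constructor; lia.
case: ltnP => h2; first by constructor.
have E k :
    lattice_coord (lattice_point (line_coord i s j)) k = line_coord i s j k.
  by rewrite lattice_pointE// /line_coord; do 2?[case: ifP => _]; lia.
have [E0 E1 E2] : [/\ line_coord i s j i = s,
    line_coord i s j (ordS i) = 3 * n - s - j &
    line_coord i s j (ordS (ordS i)) = j].
  by rewrite /line_coord ?(eqxx, ordS_eqF).
constructor; rewrite ?E//.
rewrite /in_hexagon (sum_ordS _ i) !E E0 E1 E2; apply/andP; split.
  by apply/eqP; lia.
apply/forallP => k; rewrite E.
by case: (ordS_cases i k) => ->; rewrite ?E0 ?E1 ?E2; lia.
Qed.

Definition line_edge : finType := ('I_3 * 'I_(2 * n).+1 * 'I_(3 * n))%type.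
Definition line_src (m : line_edge) := line m.1.1 m.1.2 m.2.
Definition line_dst (m : line_edge) := line m.1.1 m.1.2 m.2.+1.
Definition line_weight (m : line_edge) :=
  if m.1.2 == 0 :> nat then 2 * n else 1.

                                                                     
(** Contraction makes coordinate [i] jump from [2n] to [3n] at corner [i]; clipping at [2n + 1]
    turns this into a unit step. *)
Definition level (i : 'I_3) (v : lattice_node) :=
  minn (lattice_coord v i) (2 * n).+1.

Lemma level_corner i : level i (corner i) = (2 * n).+1.
Proof. by rewrite /level cornerE eqxx (minn_idPr _)//; lia. Qed.

Definition lattice_valid (i : 'I_3) v := in_hexagon v \/ v = corner i.

Lemma line_clamp i s j : 3 * n - s <= j -> line i s j = line i s (3 * n - s).
Proof. by move=> js; rewrite /line minnn (minn_idPr js). Qed.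

Lemma hexagon_le v k : in_hexagon v -> lattice_coord v k <= 2 * n.
Proof. by move=> /andP[_ /forallP]. Qed.

Lemma line_valid i a s j : s <= 2 * n ->
  (forall k, k != i -> line a s j != corner k) -> lattice_valid i (line a s j).
Proof.
move=> s2; wlog js : j / j <= 3 * n - s.
  move=> H; have [/H//|/ltnW/line_clamp ->] := leqP j (3 * n - s).
  exact: H.
have cornerP c : (forall k, k != i -> corner c != corner k) ->
    lattice_valid i (corner c).
  have [-> _|ci /(_ _ ci)] := eqVneq c i; first by right.
  by rewrite eqxx.
by case: lineP => // [_|_|hx _ _ _ _]; [exact: cornerP|exact: cornerP|left].
Qed.

(** Corners other than [i] are excluded because coordinate [i] drops abruptly to 0 there; class [i]
    does not contain them. *)
Lemma line_step_level i a s j : s <= 2 * n ->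
  (forall k, k != i -> line a s j != corner k) ->
  (forall k, k != i -> line a s j.+1 != corner k) ->
  level i (line a s j) <= (level i (line a s j.+1)).+1 /\
  level i (line a s j.+1) <= (level i (line a s j)).+1.
Proof.
move=> s2; have [js|js] := leqP (3 * n - s) j.
  by rewrite !line_clamp ?leqW// => _ _; split.
have cornerP c : (forall k, k != i -> corner c != corner k) -> c = i.
  by move=> H; apply/eqP; apply: contraT => /H; rewrite eqxx.
case: (lineP a s2 (ltnW js)) => [h|h|hx h0 h1 h2];
  case: (lineP a s2 js) => [h'|h'|hx' h0' h1' h2'].
- by [].
- by lia.
- move=> /cornerP ai _; rewrite -ai level_corner /level h1'; split; lia.
- by lia.
- by [].
- by have := hexagon_le (ordS (ordS a)) hx'; lia.
- by have := hexagon_le (ordS a) hx; lia.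
- by move=> _ /cornerP ai; rewrite -ai level_corner /level h2; split; lia.
- move=> _ _; rewrite /level; case: (ordS_cases a i) => ->;
  by rewrite ?h0 ?h1 ?h2 ?h0' ?h1' ?h2'; split; lia.
Qed.

End Lattice.

(** * Every cut of the lattice costs at least [12n - 4] *)

Section LatticeLabeling.
Variable n : nat.
Hypothesis n_gt0 : (0 < n)%N.
Local Open Scope nat_scope.
Variable l : lattice_node n -> 'I_3.
Hypothesis l_corner : forall i, l (corner n i) = i.
Notation connected_by T :=
  (connect (adjacent_in (@line_src n) (@line_dst n) T)).
Hypothesis l_connected : forall v, connected_by (fun=> tt) (corner n ord0) v ->
  at_terminal (@line_src n) (@line_dst n) (corner n) l v.

Lemma edge_between_line i s j : s <= 2 * n -> j < 3 * n ->
  exists m : line_edge n, edge_between (@line_src n) (@line_dst n)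
    (line n i s j) (line n i s j.+1) m.
Proof.
rewrite -ltnS => s2 j3; exists (i, Ordinal s2, Ordinal j3).
by rewrite /edge_between /line_src /line_dst /= !eqxx.
Qed.

Lemma connect_line i s j : s <= 2 * n ->
  connected_by (fun=> tt) (line n i s 0) (line n i s j).
Proof.
move=> s2; elim: j => [|j IHj]; first exact: connect0.
apply: connect_trans IHj _; have [j3|j3] := ltnP j (3 * n).
  apply: connect1; rewrite /adjacent_in eqxx; apply/existsP.
  exact: edge_between_line.
by rewrite !line_clamp ?connect0// (leq_trans (leq_subr _ _))// ltnW.
Qed.

Lemma connect_corner i : connected_by (fun=> tt) (corner n ord0) (corner n i).
Proof.
have step k : connected_by (fun=> tt) (corner n k) (corner n (ordS k)).
  have := @connect_line (ordS (ordS k)) 0 (3 * n) (leq0n _).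
  by rewrite line_left// line_right// ordS3.
case: (ordS_cases ord0 i) => ->; first exact: connect0.
  exact: step.
exact: connect_trans (step _) (step _).
Qed.

Lemma connect_corner_line i s j : s <= 2 * n ->
  connected_by (fun=> tt) (corner n ord0) (line n i s j).
Proof.
move=> s2; apply: connect_trans (connect_line i j s2).
rewrite line_left_side//; apply: connect_trans (connect_line _ _ (leq0n _)).
by rewrite line_left//; exact: connect_corner.
Qed.

Lemma hexagon_at_terminal v : in_hexagon v ->
  at_terminal (@line_src n) (@line_dst n) (corner n) l v.
Proof.
move=> hv; apply: l_connected; rewrite (hexagon_line n_gt0 ord0 hv).
by apply: connect_corner_line; exact: hexagon_le.
Qed.

Lemma adjacent_level i u v :
  adjacent_in (@line_src n) (@line_dst n) l u v -> l u = i ->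
  [/\ l v = i, lattice_valid i v & level i u <= (level i v).+1].
Proof.
move=> /andP[/eqP luv /existsP[[[a s] j] uv]] lu.
have s2 : s <= 2 * n by rewrite -ltnS.
have lv : l v = i by rewrite -luv.
have not_corner w : l w = i -> forall k, k != i -> w != corner n k.
  move=> lw k ki; apply: contra ki => /eqP wk; rewrite -lw wk l_corner.
  exact: eqxx.
move: uv; rewrite /edge_between /line_src /line_dst /=.
move=> /orP[]/andP[/eqP E1 /eqP E2]; split => //.
- by rewrite -E2; apply: line_valid => //; rewrite E2; exact: not_corner.
- have := @line_step_level n n_gt0 i a s j s2; rewrite E1 E2.
  by case/(_ (not_corner _ lu) (not_corner _ lv)).
- by rewrite -E1; apply: line_valid => //; rewrite E1; exact: not_corner.
- have := @line_step_level n n_gt0 i a s j s2; rewrite E1 E2.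
  by case/(_ (not_corner _ lv) (not_corner _ lu)).
Qed.

                                                                            
                                                                  
(** A discrete intermediate value argument: a path inside class [i] from corner [i] to [v] descends
    by at most one level per edge, so it meets level [s]. *)
Lemma region_level i v s :
  in_hexagon v -> l v = i -> lattice_coord v i <= s <= 2 * n ->
  exists2 j, j <= 3 * n & l (line n i s j) = i.
Proof.
move=> hv lv /andP[vs s2].
suff [x [hx lx xs]] : exists x, [/\ in_hexagon x, l x = i & level i x = s].
  have xi : lattice_coord x i = s by move: xs; rewrite /level; lia.
  exists (lattice_coord x (ordS (ordS i))).
    by apply: leq_trans (hexagon_le _ hx) _; lia.
  by rewrite -xi -hexagon_line.
have /connectP[p pp vE] := hexagon_at_terminal hv; rewrite lv in pp vE.
have : level i (last (corner n i) p) <= s by rewrite -vE /level geq_min vs.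
have : s < level i (corner n i) by rewrite level_corner.
have := l_corner i; move: (corner n i) pp {vE} => u.
elim: p u => [|a p IHp] u /=; first by move=> _ _; lia.
move=> /andP[ua ap] lu su ls.
have [la va ula] := adjacent_level ua lu.
have [sa|as_] := ltnP s (level i a); first exact: IHp ls.
exists a; have {}as_ : level i a = s by lia.
split => //; case: va => // aE; move: as_; rewrite aE level_corner//; lia.
Qed.

Lemma line_label i s j : s <= 2 * n -> l (line n i s j) = i ->
  in_hexagon (line n i s j) /\ lattice_coord (line n i s j) i = s.
Proof.
move=> s2; wlog js : j / j <= 3 * n - s.
  move=> H; have [/H//|/ltnW/line_clamp ->] := leqP j (3 * n - s).
  exact: H.
case: lineP => // [_|_].
- by rewrite l_corner => /eqP; rewrite ordS_eqF.
- by rewrite l_corner => /eqP; rewrite ordS_eqF.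
Qed.

Definition line_changes i s := changes (fun j => l (line n i s j)) 0 (3 * n).

Lemma label_left i s : s < n -> l (line n i s 0) = ordS i.
Proof. by move=> sn; rewrite line_left. Qed.

Lemma label_right i s : s < n -> l (line n i s (3 * n)) = ordS (ordS i).
Proof. by move=> sn; rewrite line_right. Qed.

Lemma line_changes_ge1 i s : s < n -> 0 < line_changes i s.
Proof.
move=> sn; apply: changes_ge1 => //.
by rewrite label_left// label_right// ordS_eqF.
Qed.

Lemma line_changes_ge2 i s j : s < n -> j <= 3 * n -> l (line n i s j) = i ->
  1 < line_changes i s.
Proof.
move=> sn j3 lij; apply: (@changes_ge2 _ _ 0 j) => //.
  by rewrite lij label_left// ordS_eqF.
by rewrite lij label_right// ordS_eqF.
Qed.

Definition row_changes i :=
  2 * n * line_changes i 0 + \sum_(s < 2 * n) line_changes i s.+1.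

(** The lines of levels 1 to [n - 1] join two distinct terminals. *)
Lemma row_changes_ge i : 2 * n * line_changes i 0 + n.-1 <= row_changes i.
Proof.
rewrite leq_add2l; have := @sum_interval_ge 0 n.-1 (2 * n).
rewrite subn0 => H; apply: leq_trans (H _) _; first by lia.
apply: leq_sum => s _; case: ltnP => //= sn; apply: line_changes_ge1; lia.
Qed.

(** A class [i] that reaches the side opposite its corner meets every line on the way; those of
    level below [n] join the two other terminals and so change label twice. *)
Lemma row_changes_ge_touching i j : l (line n i 0 j) = i ->
  2 * n * line_changes i 0 + n.-1.*2 <= row_changes i.
Proof.
move=> lij; rewrite leq_add2l; have := @sum_interval_ge 0 n.-1 (2 * n).
rewrite subn0 => H; rewrite -mul2n.
apply: leq_trans (leq_mul (leqnn 2) (H _)) _; first by lia.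
rewrite big_distrr; apply: leq_sum => s _; case: ltnP => //= sn.
have [hj cj] := line_label (leq0n _) lij.
have [j' j3 lj'] := @region_level i _ s.+1 hj lij ltac:(rewrite cj; lia).
by apply: line_changes_ge2 lj'; lia.
Qed.

(** [m] is the least level of class [i] in the hexagon, or [2n + 1] if the class has no point
    there. *)
Lemma region_min_level i : (forall j, l (line n i 0 j) != i) ->
  exists m, [/\ 0 < m <= (2 * n).+1,
    forall v, in_hexagon v -> l v = i -> m <= lattice_coord v i &
    forall s, m <= s <= 2 * n -> exists2 j, j <= 3 * n & l (line n i s j) = i].
Proof.
move=> ni; pose Q x := (x == (2 * n).+1) ||
  [exists v, [&& in_hexagon v, l v == i & lattice_coord v i == x]].
have exQ : exists x, Q x by exists (2 * n).+1; rewrite /Q eqxx.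
case: (ex_minnP exQ) => m Qm mmin; exists m.
have low v : in_hexagon v -> l v = i -> m <= lattice_coord v i.
  move=> hv lv; apply: mmin; apply/orP; right; apply/existsP; exists v.
  by rewrite hv lv !eqxx.
split => //.
  rewrite mmin /Q ?eqxx// andbT lt0n; apply/eqP => m0; move: Qm.
  rewrite /Q m0 /= => /existsP[v /and3P[hv /eqP lv /eqP vi]].
  have := ni (lattice_coord v (ordS (ordS i))).
  by rewrite -[X in line n i X _]vi -hexagon_line// lv eqxx.
move=> s /andP[ms s2]; move: Qm => /orP[/eqP mE|]; first by lia.
move=> /existsP[v /and3P[hv /eqP lv /eqP vi]].
by apply: region_level hv lv _; rewrite vi ms.
Qed.

                                                                             
                                            
(** Otherwise some hexagon point has each coordinate [i] below [m i], and its own label gives a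
    contradiction. *)
Lemma sum_min_level (m : 'I_3 -> nat) :
  (forall i, 0 < m i <= (2 * n).+1) ->
  (forall i v, in_hexagon v -> l v = i -> m i <= lattice_coord v i) ->
  \sum_i m i <= 3 * n + 2.
Proof.
move=> mb low; rewrite leqNgt (sum_ordS _ ord0); apply/negP => big.
set a := ord0 in big; pose b := ordS a; pose c := ordS b.
have := mb a; have := mb b; have := mb c; rewrite -/b -/c in big => mc mb' ma.
pose s := (m a).-1; pose j := minn (m c).-1 (3 * n - s).
have s2 : s <= 2 * n by rewrite /s; lia.
have js : j <= 3 * n - s by rewrite /j geq_minr.
case: (lineP n_gt0 a s2 js) => [||hv h0 h1 h2]; rewrite ?/j ?/s; try lia.
set v := lattice_point n _ in hv h0 h1 h2.
have := low (l v) v hv erefl.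
by case: (ordS_cases a (l v)) => ->; rewrite ?h0 ?h1 ?h2 -/b -/c /j /s; lia.
Qed.

                                                                             
                                                                             
(** Below level [max(A, B)] the two ends of a line differ in label: one change. From level [m] up to
    [min(A, B)] the ends have the two other labels and class [i] occurs in between: a second change.
    Level 0 is counted apart with weight [2n], whence the predecessors. *)
Lemma row_changes_ge_switch i m A B :
  A <= (2 * n).+1 -> B <= (2 * n).+1 -> 0 < A -> 0 < m ->
  (forall s, s <= 2 * n ->
    l (line n i s (3 * n)) = if s < A then ordS (ordS i) else i) ->
  (forall s, s <= 2 * n -> l (line n i s 0) = if s < B then ordS i else i) ->
  (forall s, m <= s <= 2 * n -> exists2 j, j <= 3 * n & l (line n i s j) = i) ->
  2 * n + (A + B) <= row_changes i + (m + 1).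
Proof.
move=> A2 B2 A0 m0 right left mid.
have D0 : 0 < line_changes i 0 by exact: line_changes_ge1.
have := @sum_interval_ge 0 (maxn A B).-1 (2 * n) ltac:(lia).
have := @sum_interval_ge m.-1 (minn A B).-1 (2 * n) ltac:(lia).
suff : \sum_(s < 2 * n) (m.-1 <= s < (minn A B).-1) +
   \sum_(s < 2 * n) (0 <= s < (maxn A B).-1) <=
   \sum_(s < 2 * n) line_changes i s.+1.
  rewrite /row_changes; have := leq_mul (leqnn (2 * n)) D0; rewrite muln1; lia.
rewrite -big_split; apply: leq_sum => s _ /=.
have s2 : s.+1 <= 2 * n by [].
have [sM|sM] := ltnP s (maxn A B).-1; last first.
  by case: (ltnP s (minn A B).-1) => sm; rewrite ?andbF//; lia.
have neq : l (line n i s.+1 0) != l (line n i s.+1 (3 * n)).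
  rewrite right// left//; case: ifP => sB; case: ifP => sA;
    rewrite ?ordS_eqF//; lia.
have ge1 : 0 < line_changes i s.+1 by exact: changes_ge1.
case: (boolP (m.-1 <= s < (minn A B).-1)) => [/andP[ms sm]|_] //.
have [j j3 lj] := mid s.+1 ltac:(lia).
apply: (@changes_ge2 _ _ 0 j) => //; rewrite lj ?right ?left//.
  by rewrite ifT ?ordS_eqF//; lia.
by rewrite ifT ?ordS_eqF//; lia.
Qed.

Lemma row_changes_sum_ge : 12 * n <= \sum_i row_changes i + 4.
Proof.
have side i : l (line n i 0 0) != l (line n i 0 (3 * n)).
  by rewrite label_left// label_right// ordS_eqF.
have D0 i : 2 * n <= 2 * n * line_changes i 0.
  by rewrite leq_pmulr// line_changes_ge1.
(* A side with three changes: the sides cost [6n + 4n] and the other lines [3(n - 1)]. *)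
have [[i Di]|no3] := pselect (exists i, 2 < line_changes i 0).
  have := leq_mul (leqnn (2 * n)) Di; rewrite (sum_ordS _ i).
  have := row_changes_ge i; have := row_changes_ge (ordS i).
  have := row_changes_ge (ordS (ordS i)).
  by have := D0 (ordS i); have := D0 (ordS (ordS i)); lia.
(* Class [i] touches its opposite side: the sides cost [4n + 4n], the other lines [2(n - 1)] in
   direction [i] and [n - 1] in each other direction. The sum is exactly [12n - 4]. *)
have [[i [j lij]]|no2] := pselect (exists i j, l (line n i 0 j) = i).
  have [hj cj] := line_label (leq0n _) lij.
  have j3 : lattice_coord (line n i 0 j) (ordS (ordS i)) <= 3 * n.
    by apply: leq_trans (hexagon_le _ hj) _; lia.
  have lij' : l (line n i 0 (lattice_coord (line n i 0 j) (ordS (ordS i)))) = i.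
    by have := hexagon_line n_gt0 i hj; rewrite cj => <-.
  have := leq_mul (leqnn (2 * n)) (line_changes_ge2 n_gt0 j3 lij').
  rewrite (sum_ordS _ i).
  have := row_changes_ge_touching lij; have := row_changes_ge (ordS i).
  have := row_changes_ge (ordS (ordS i)).
  by have := D0 (ordS i); have := D0 (ordS (ordS i)); lia.
have no2' i j : l (line n i 0 j) != i.
  by apply/eqP => lij; apply: no2; exists i, j.
(* In the remaining case every side switches once between its two end labels, after position
   [u i]. *)
have /choice[u uP] i : exists u, u < 3 * n /\ forall j, j <= 3 * n ->
    l (line n i 0 j) = if j <= u then ordS i else ordS (ordS i).
  have := @changes_cases _ (fun j => l (line n i 0 j)) _ (side i).
  rewrite label_left// label_right//.
  case=> [[u u3 uE]|[[j j3 /andP[j1 j2]] _]|D3]; first by exists u.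
    have := no2' i j.
    by case: (ordS_cases i (l (line n i 0 j))) j1 j2 => ->; rewrite eqxx.
  by case: no3; exists i.
have u2 i : n.-1 <= u i <= 2 * n.
  have [u3 uE] := uP i; apply/andP; split.
    rewrite leqNgt; apply/negP => un.
    have := uE n.-1 ltac:(lia); rewrite leqNgt un /=.
    rewrite /line (minn_idPl _) ?ifT; try lia.
    by rewrite l_corner => /eqP; rewrite ordS_eqF.
  rewrite leqNgt; apply/negP => un.
  have := uE (2 * n).+1 ltac:(lia); rewrite un.
  rewrite /line (minn_idPl _); last by lia.
  rewrite ifN; last by lia.
  rewrite ifT; last by lia.
  by rewrite l_corner => /eqP; rewrite ordS_eqF.
have /choice[m mP] i := region_min_level (no2' i).
have mS : \sum_i m i <= 3 * n + 2.
  by apply: sum_min_level => [i|i v]; have [mb low _] := mP i; [|exact: low].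
(* Summed cyclically the [u] cancel, leaving [15n + 3]; subtracting [sum_i (m i + 1)], which is at
   most [3n + 5], leaves [12n - 2]. *)
have row i : 2 * n + ((u (ordS i)).+1 + (3 * n - u (ordS (ordS i)))) <=
    row_changes i + (m i + 1).
  have [/andP[m0 _] _ mid] := mP i.
  have := u2 (ordS i); have := u2 (ordS (ordS i)) => h1 h2.
  apply: row_changes_ge_switch => //; try lia.
  - move=> s s2; rewrite line_right_side//.
    by have [_ ->] := uP (ordS i); rewrite ?ordS3 ?ltnS//; lia.
  - move=> s s2; rewrite line_left_side//.
    have [_ ->] := uP (ordS (ordS i)); last by lia.
    by rewrite ordS3; case: ifP; case: ifP => //; lia.
move: mS; rewrite !(sum_ordS _ ord0).
have := row ord0; have := row (ordS ord0); have := row (ordS (ordS ord0)).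
rewrite ordS3; have := u2 ord0; have := u2 (ordS ord0).
by have := u2 (ordS (ordS ord0)); lia.
Qed.

End LatticeLabeling.

Section LatticeCut.
Variable n : nat.
Hypothesis n_gt0 : (0 < n)%N.
Local Open Scope nat_scope.

Lemma sum_line_edge (h : 'I_3 -> nat -> nat -> nat) :
  \sum_(m : line_edge n) line_weight m * h m.1.1 m.1.2 m.2 =
  \sum_i (2 * n * (\sum_(j < 3 * n) h i 0 j) +
          \sum_(s < 2 * n) \sum_(j < 3 * n) h i s.+1 j).
Proof.
rewrite -(pair_bigA _ (fun (p : 'I_3 * 'I_(2 * n).+1) (j : 'I_(3 * n)) =>
  line_weight (p, j) * h p.1 p.2 j))/=.
rewrite -(pair_bigA _ (fun (i : 'I_3) (s : 'I_(2 * n).+1) =>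
  \sum_(j < 3 * n) line_weight (i, s, j) * h i s j))/=.
apply: eq_bigr => i _; rewrite big_ord_recl; congr addn.
  by rewrite big_distrr.
apply: eq_bigr => s _; apply: eq_bigr => j _.
by rewrite /line_weight /= mul1n.
Qed.

Lemma lattice_weighted_changes_ge (l : lattice_node n -> 'I_3) :
  (forall i, l (corner n i) = i) ->
  12 * n <= weighted_changes (@line_src n) (@line_dst n) (@line_weight n) l + 4.
Proof.
move=> lc; have [l' [l'c l'l l'conn]] := connected_labeling (@line_src n)
  (@line_dst n) (@line_weight n) ord0 lc.
apply: leq_trans (row_changes_sum_ge n_gt0 l'c l'conn) _; rewrite leq_add2r.
apply: leq_trans l'l; rewrite /weighted_changes.
have := sum_line_edge (fun i s j => l' (line n i s j) != l' (line n i s j.+1)).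
rewrite /line_src /line_dst => ->; apply: eq_leq; apply: eq_bigr => i _.
rewrite /row_changes /line_changes /changes big_mkord; congr addn.
by apply: eq_bigr => s _; rewrite big_mkord.
Qed.

End LatticeCut.

(** * The volume of the lattice embedding *)

Section LatticeLength.
Variable n : nat.
Hypothesis n_gt0 : (0 < n)%N.
Local Open Scope nat_scope.

Definition lattice_dist (u v : lattice_node n) : nat :=
  \sum_k ((lattice_coord u k - lattice_coord v k) +
          (lattice_coord v k - lattice_coord u k)).

Lemma line_coords i s j : s <= 2 * n ->
  let p := line n i s j in let j' := minn j (3 * n - s) in
  [/\ lattice_coord p i =
        if s + j' < n then 0 else if 2 * n < j' then 0 else s,
      lattice_coord p (ordS i) =
        if s + j' < n then 3 * n else if 2 * n < j' then 0 else 3 * n - s - j' &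
      lattice_coord p (ordS (ordS i)) =
        if s + j' < n then 0 else if 2 * n < j' then 3 * n else j'].
Proof.
move=> s2 p j'; have -> : p = line n i s j'.
  by rewrite /p /j'; case: leqP => // /ltnW; exact: line_clamp.
have j3 : j' <= 3 * n - s by exact: geq_minr.
case: (lineP n_gt0 i s2 j3) => [h|h|hv h0 h1 h2].
- by rewrite !(cornerE, eqxx, ordS_eqF) h.
- have F : (s + j' < n) = false by lia.
  by rewrite !(cornerE, eqxx, ordS_eqF) h F.
- have := hexagon_le (ordS i) hv; have := hexagon_le (ordS (ordS i)) hv.
  rewrite h0 h1 h2 => j2 j1; have F : (s + j' < n) = false by lia.
  by rewrite F ltnNge j2.
Qed.

Lemma lattice_coord_le (v : lattice_node n) k : lattice_coord v k <= 3 * n.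
Proof. by rewrite -ltnS; exact: ltn_ord. Qed.

Lemma line_in_plane i s j : s <= 2 * n ->
  \sum_k lattice_coord (line n i s j) k = 3 * n.
Proof.
move=> s2; have [c0 c1 c2] := line_coords i j s2.
rewrite (sum_ordS _ i) c0 c1 c2.
have j3 := geq_minr j (3 * n - s).
by case: ltnP => ?; [lia|case: ltnP => ?; lia].
Qed.

Lemma telescope_dist (g : nat -> nat) N : {homo g : a b / a <= b} ->
  \sum_(j < N) (g j.+1 - g j) = g N - g 0.
Proof.
move=> gh; rewrite -(big_mkord xpredT (fun j => g j.+1 - g j)).
by rewrite telescope_sumn.
Qed.

(** For [s < n] the line makes a detour to two corners: [2n] to enter the hexagon, [2(n + s)] across
    it and [2n] to leave. *)
Definition line_length_bound s :=
  if s < n then 2 * (3 * n + s) else 2 * (3 * n - s).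

                                                                             
                                                                   
(** Two coordinates are monotone along the line, and coordinate [i] is the difference of the
    monotone steps [p] and [q], so all four sums telescope. *)
Lemma line_length i s : s <= 2 * n ->
  \sum_(j < 3 * n) lattice_dist (line n i s j) (line n i s j.+1) <=
  line_length_bound s.
Proof.
move=> s2.
pose c1 j := 3 * n - lattice_coord (line n i s j) (ordS i).
pose c2 j := lattice_coord (line n i s j) (ordS (ordS i)).
pose p j := if s + minn j (3 * n - s) < n then 0 else s.
pose q j := if 2 * n < minn j (3 * n - s) then s else 0.
have c1E j : c1 j = 3 * n - (if s + minn j (3 * n - s) < n then 3 * n else
    if 2 * n < minn j (3 * n - s) then 0 else 3 * n - s - minn j (3 * n - s)).
  by rewrite /c1; have [_ -> _] := line_coords i j s2.
have c2E j : c2 j = if s + minn j (3 * n - s) < n then 0 else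
    if 2 * n < minn j (3 * n - s) then 3 * n else minn j (3 * n - s).
  by rewrite /c2; have [_ _ ->] := line_coords i j s2.
have hc1 : {homo c1 : a b / a <= b}.
  move=> a b ab; rewrite !c1E; do 4?[case: ltnP => ?]; lia.
have hc2 : {homo c2 : a b / a <= b}.
  move=> a b ab; rewrite !c2E; do 4?[case: ltnP => ?]; lia.
have hp : {homo p : a b / a <= b}.
  move=> a b ab; rewrite /p; do 2?[case: ltnP => ?]; lia.
have hq : {homo q : a b / a <= b}.
  move=> a b ab; rewrite /q; do 2?[case: ltnP => ?]; lia.
apply: (@leq_trans (\sum_(j < 3 * n) ((c1 j.+1 - c1 j) + (c2 j.+1 - c2 j) +
    (p j.+1 - p j) + (q j.+1 - q j)))).
  apply: leq_sum => j _; rewrite /lattice_dist (sum_ordS _ i).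
  have := hc1 _ _ (leqnSn j); have := hc2 _ _ (leqnSn j).
  have := hp _ _ (leqnSn j); have := hq _ _ (leqnSn j).
  have [-> e1 _] := line_coords i j s2.
  have [-> e1' _] := line_coords i j.+1 s2.
  have := lattice_coord_le (line n i s j) (ordS i).
  have := lattice_coord_le (line n i s j.+1) (ordS i).
  rewrite /c1 /c2 /p /q.
  do 4?[case: ltnP => ?]; lia.
rewrite !big_split/= !telescope_dist// !c1E !c2E /p /q /line_length_bound.
by rewrite min0n; case: (ltnP s n) => sn; do 4?[case: ltnP => ?]; lia.
Qed.

End LatticeLength.

Section LatticeVolume.
Variable n : nat.
Hypothesis n_gt0 : (0 < n)%N.

(** The side gives [12n^2], levels 1 to [n - 1] give [7n^2 - 7n], and levels [n] to [2n] give
    [3n^2 + 3n]. *)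
Lemma sum_line_length_bound : (2 * n * line_length_bound n 0 +
  \sum_(s < 2 * n) line_length_bound n s.+1 <= 22 * n ^ 2)%N.
Proof.
have rise c m : (\sum_(s < m) (c + 2 * s.+1) = m * c + m * m.+1)%N.
  by elim: m => [|m IHm]; rewrite ?big_ord0// big_ord_recr/= IHm; nia.
have fall c m : (2 * m <= c.+2)%N ->
    (\sum_(s < m) (c - 2 * s) + m * m.-1 = m * c)%N.
  elim: m => [|m IHm] mc; first by rewrite big_ord0.
  rewrite big_ord_recr/=; have := IHm ltac:(lia).
  by case: m mc {IHm} => //=; nia.
have -> : (2 * n = n.-1 + n.+1)%N by lia.
rewrite big_split_ord/=.
rewrite (eq_bigr (fun s : 'I_n.-1 => 6 * n + 2 * s.+1)%N) => [|s _]; last first.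
  by rewrite /line_length_bound ifT; have := ltn_ord s; lia.
rewrite (eq_bigr (fun s : 'I_n.+1 => 4 * n - 2 * s)%N) => [|s _]; last first.
  by rewrite /line_length_bound ifN; have := ltn_ord s; lia.
have := fall (4 * n)%N n.+1 ltac:(lia).
by rewrite rise /line_length_bound n_gt0 /=; nia.
Qed.

Lemma sum_line_edge_length :
  (\sum_(m : line_edge n) line_weight m * lattice_dist (line_src m) (line_dst m)
    <= 66 * n ^ 2)%N.
Proof.
have := @sum_line_edge n (fun i s j =>
  lattice_dist (line n i s j) (line n i s j.+1)).
rewrite /line_src /line_dst => ->.
apply: (@leq_trans (\sum_(i < 3) 22 * n ^ 2)%N); last first.
  by rewrite sum_nat_const card_ord; lia.
apply: leq_sum => i _; apply: leq_trans sum_line_length_bound.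
apply: leq_add; first by rewrite leq_mul2l line_length// orbT.
by apply: leq_sum => s _; exact: line_length.
Qed.

End LatticeVolume.

(** * The lattice as an instance, and the conclusion *)

Section LatticeInstance.
Context (R : realType) (n : nat).
Hypothesis n_gt0 : (0 < n)%N.

Definition lattice_instance : instance R 3 :=
  simple_instance R (@line_src n) (@line_dst n) (@line_weight n)
    (corner_inj n_gt0).

Lemma lattice_min_cut_cost : (12 * n)%:R - 4 <= min_cut_cost lattice_instance.
Proof.
apply: (min_cut_cost_ge ord0) => l lt.
rewrite /labeling_cost.
rewrite (@sum_simple_instance R _ _ _ _ _ _ _ _ (fun u v => (l u != l v)%:R)).
- have := lattice_weighted_changes_ge n_gt0 lt.
  rewrite -(ler_nat R) natrD /weighted_changes natr_sum lerBlDr.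
  by under eq_bigr do rewrite natrM.
- by move=> u v; rewrite eq_sym.
- by move=> v; rewrite eqxx.
Qed.

                                                                               
               
(** Nodes off the plane meet no edge and go to an arbitrary vertex. *)
Definition lattice_embedding (v : lattice_node n) : 'cV[R]_3 :=
  if (\sum_k lattice_coord v k == 3 * n)%N
  then \col_k ((lattice_coord v k)%:R / (3 * n)%:R) else simplex_vertex R ord0.

Lemma lattice_embeddingP : embedding (G := lattice_instance) lattice_embedding.
Proof.
have n0 : (3 * n)%:R != 0 :> R by rewrite pnatr_eq0 muln_eq0/= -lt0n.
split=> [v|i]; rewrite /lattice_embedding; last first.
  have cE k : lattice_coord (corner n i) k = (if k == i then 3 * n else 0)%N.
    exact: cornerE.
  rewrite ifT.
    apply/matrixP => k j; rewrite ord1 !mxE cE eqxx andbT.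
    by case: eqP => _; rewrite ?mul0r ?divff.
  by rewrite (sum_ordS _ i) !cE eqxx !ordS_eqF !addn0.
case: ifP => [/eqP vn|_]; split.
- by move=> k; rewrite mxE divr_ge0.
- under eq_bigr do rewrite mxE.
  by rewrite -mulr_suml -natr_sum vn divff.
- by move=> k; rewrite mxE.
- rewrite (bigD1 ord0)//= mxE !eqxx big1 ?addr0// => k k0.
  by rewrite mxE (negbTE k0).
Qed.

Lemma lattice_seg_length (u v : lattice_node n) :
  (\sum_k lattice_coord u k = 3 * n)%N ->
  (\sum_k lattice_coord v k = 3 * n)%N ->
  seg_length (lattice_embedding u) (lattice_embedding v) =
  (lattice_dist u v)%:R / (6 * n)%:R.
Proof.
move=> un vn; rewrite /lattice_embedding un vn eqxx /seg_length /lattice_dist.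
have n0 : 0 < n%:R :> R by rewrite ltr0n.
rewrite natr_sum !mulr_suml mulr_sumr; apply: eq_bigr => k _; rewrite !mxE.
have v0 : 0 <= (3 * n)%:R^-1 :> R by rewrite invr_ge0.
rewrite -mulrBl normrM (ger0_norm v0).
have -> : `|(lattice_coord u k)%:R - (lattice_coord v k)%:R| =
  ((lattice_coord u k - lattice_coord v k) +
   (lattice_coord v k - lattice_coord u k))%N%:R :> R.
  have [uv|/ltnW uv] := leqP (lattice_coord u k) (lattice_coord v k).
    rewrite distrC -natrB// ger0_norm//; congr _%:R; lia.
  rewrite -natrB// ger0_norm//; congr _%:R; lia.
rewrite !natrM; field; exact: lt0r_neq0.
Qed.

(** Lattice distances are divided by [6n], that is [3n] for the scaling and 2 for the half in the
    length: [66n^2 / 6n = 11n]. *)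
Lemma lattice_volume :
  volume (G := lattice_instance) lattice_embedding <= (11 * n)%:R.
Proof.
rewrite /volume (@sum_simple_instance R _ _ _ _ _ _ _ _ (fun u v =>
  seg_length (lattice_embedding u) (lattice_embedding v))).
- have n0 : 0 < (6 * n)%:R :> R by rewrite ltr0n muln_gt0.
  rewrite -(ler_pM2r n0) mulr_suml -natrM.
  apply: le_trans (_ : (66 * n ^ 2)%:R <= _); last by rewrite ler_nat; lia.
  have := sum_line_edge_length n_gt0; rewrite -(ler_nat R); apply: le_trans.
  rewrite natr_sum; apply: ler_sum => m _.
  have s2 : (m.1.2 <= 2 * n)%N by rewrite -ltnS.
  rewrite lattice_seg_length ?line_in_plane// [leRHS]natrM -mulrA divfK//.
  by rewrite gt_eqF.
- move=> u v; rewrite /seg_length; congr (_ * _); apply: eq_bigr => k _.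
  exact: distrC.
- by move=> v; apply/eqP; rewrite seg_length_eq0.
Qed.

End LatticeInstance.

Lemma lee_12_11 (R : realType) (x : \bar R) :
  (forall n, (0 < n)%N -> ((((12 * n)%:R - 4) / (11 * n)%:R)%:E <= x)%E) ->
  ((12 / 11)%:E <= x)%E.
Proof.
case: x => [r| |] H; last by have := H 1%N isT.
  rewrite lee_fin leNgt; apply/negP => r12.
  pose d := 12 - 11 * r; have d0 : 0 < d by rewrite /d; lra.
  have := H (Num.truncn (4 / d)).+1 isT; set N := (Num.truncn _).+1.
  have : 4 / d < N%:R by exact: truncnS_gt.
  rewrite ltr_pdivrMr// => Nd.
  rewrite lee_fin ler_pdivrMr ?ltr0n// !natrM leNgt => /negP; apply.
  by move: Nd; rewrite /d; lra.
exact: leey.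
Qed.

Theorem theorem5p1 (R : realType) :
  ((12 / 11)%R%:E <= min_max_density R 3)%E /\
  integrality_gap R 3 = (12 / 11)%R%:E.
Proof.
split.
  apply: le_ereal_inf_tmp => _ [P _ <-]; apply: lee_12_11 => n n0.
  have := min_cut_cost_le_density P (lattice_embeddingP R n0).
  have mc := lattice_min_cut_cost R n0; have vol := lattice_volume R n0.
  set V := volume _ in vol *.
  have vol0 : 0 <= V.
    by apply: sumr_ge0 => e _; rewrite mulr_ge0 ?cost_ge0 ?seg_length_ge0.
  have n11 : 0 < (11 * n)%:R :> R by rewrite ltr0n muln_gt0.
  have n1 : 1 <= n%:R :> R by rewrite ler1n.
  case: (max_density P) => [r| |] H.
  - rewrite -EFinM lee_fin in H.
    rewrite lee_fin ler_pdivrMr//; apply: (le_trans mc); apply: (le_trans H).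
    (* A negative density would force the cut cost, at least [12n - 4 > 0], to be nonpositive. *)
    have r0 : 0 <= r.
      rewrite leNgt; apply/negP => r0.
      have : r * V <= 0 by rewrite mulr_le0_ge0// ltW.
      by move=> /(le_trans H); rewrite natrM in mc; lra.
    exact: ler_wpM2l.
  - exact: leey.
  - exfalso; move: H; rewrite natrM in mc.
    move: vol0; rewrite le_eqVlt => /predU1P[<-|v0].
      by rewrite mule0 lee_fin; lra.
    by rewrite gt0_mulNye ?lte_fin// leeNy_eq.
have min_vol (G : instance R 3) f : embedding (G := G) f ->
    11 / 12 * min_cut_cost G <= volume f.
  by move=> /min_cut_cost_le_volume; lra.
apply/eqP; rewrite eq_le; apply/andP; split.
  apply: ge_ereal_sup => _ [G [mv0 ->]]; rewrite lee_fin ler_pdivrMr//.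
  suff : 11 / 12 * min_cut_cost G <= min_volume G by lra.
  apply: lb_le_inf => [|_ [f fe <-]]; last exact: min_vol.
  (* The infimum of the empty set is 0, so a positive minimum volume provides an embedding. *)
  apply/set0P; apply/negP => /eqP e0.
  by move: mv0; rewrite /min_volume e0 inf0 ltxx.
apply: lee_12_11 => n n0; have mc := lattice_min_cut_cost R n0.
have fE := lattice_embeddingP R n0.
have n1 : 1 <= n%:R :> R by rewrite ler1n.
set G := lattice_instance R n0 in mc fE *.
(* The rounding bound also shows that the lattice has positive minimum volume, as the gap
   requires. *)
have lo : 11 / 12 * min_cut_cost G <= min_volume G.
  apply: lb_le_inf => [|_ [f fe <-]]; last exact: min_vol.
  exists (volume (G := G) (@lattice_embedding R n)).
  by exists (@lattice_embedding R n).
have up : min_volume G <= (11 * n)%:R.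
  apply: le_trans (lattice_volume R n0); apply: inf_lbound.
    exists (11 / 12 * min_cut_cost G) => _ [f fe <-]; exact: min_vol.
  by exists (@lattice_embedding R n).
have mv0 : 0 < min_volume G by rewrite natrM in mc; lra.
apply: (@le_trans _ _ (min_cut_cost G / min_volume G)%:E).
  rewrite lee_fin ler_pM//.
  - by rewrite natrM in mc *; lra.
  - by rewrite lef_pV2 ?posrE//; exact: lt_le_trans up.
by apply: ereal_sup_ubound; exists G.
Qed.
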